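(* Let $p$ be a prime and let $G$ be a $2$-tuple regular finite $p$-group. Then $G$ is homocyclic, or $G$ is isomorphic to $Q_8$ or to $G_{64}$.
   Context: A finite group $G$ is $2$-tuple regular if for all pairs $(g_1,g_2),(h_1,h_2)\in G^2$ (entries may coincide) for which $g_1\mapsto h_1, g_2\mapsto h_2$ defines an isomorphism $\langle g_1,g_2\rangle\to\langle h_1,h_2\rangle$, there is a bijection $\Psi\colon G\to G$ such that for every $g\in G$ the assignment $g_1\mapsto h_1,g_2\mapsto h_2,g\mapsto\Psi(g)$ defines an isomorphism $\langle g_1,g_2,g\rangle\to\langle h_1,h_2,\Psi(g)\rangle$. A $p$-group is homocyclic if it is a direct product of copies of $C_{p^m}$ for a single $m$. $G_{64}$ is the Suzuki 2-group of order 64 (a Sylow 2-subgroup of $\mathrm{PSU}(3,4)$). *)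

(* Defs.v *)
From HB Require Import structures.
From mathcomp Require Import all_boot all_order all_algebra all_fingroup all_solvable all_field.
Set Implicit Arguments. Unset Strict Implicit. Unset Printing Implicit Defensive.
Import GRing.Theory.

Local Open Scope group_scope.

Definition assign_iso (gT : finGroupType) (xs ys : seq gT) : Prop :=
  size xs = size ys /\
  exists f : gT -> gT,
    [/\ {in <<[set x in xs]>> &, {morph f : x y / x * y}},
        {in <<[set x in xs]>> &, injective f},
        f @: <<[set x in xs]>> = <<[set y in ys]>>
      & forall i, (i < size xs)%N -> f (nth 1 xs i) = nth 1 ys i].

Definition two_tuple_regular (gT : finGroupType) (G : {set gT}) : Prop :=
  forall g1 g2 h1 h2 : gT,
    g1 \in G -> g2 \in G -> h1 \in G -> h2 \in G ->
    assign_iso [:: g1; g2] [:: h1; h2] ->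
    exists Psi : gT -> gT,
      [/\ {in G &, injective Psi}, Psi @: G = G
        & forall g, g \in G -> assign_iso [:: g1; g2; g] [:: h1; h2; Psi g]].

(* A concrete field with 16 elements (all such fields are isomorphic). *)
Definition F16 : finFieldType :=
  s2val (@pPrimePowerField 2 4 (isT : prime 2) (isT : (0 < 4)%N)).

(* The Suzuki 2-group G_64: the upper unitriangular matrices in the unitary
   group U(3,4) = { M in GL_3(F_16) | M^{sigma T} J M = J }, where sigma is the
   involution x |-> x^4 of F_16 and J the antidiagonal Hermitian form.  This is a
   Sylow 2-subgroup of U(3,4); it lies in SU(3,4) and maps isomorphically onto a
   Sylow 2-subgroup of PSU(3,4). *)
Definition antidiag3 : 'M[F16]_3 := \matrix_(i < 3, j < 3) (if ((i : nat) + j == 2)%N then 1 else 0)%R.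

Definition G64 : {set {'GL_3[F16]}} :=
  [set M : {'GL_3[F16]} |
     [forall i : 'I_3, forall j : 'I_3,
        ((j < i)%N ==> (GLval M i j == 0)%R) && ((i == j) ==> (GLval M i j == 1)%R)]
     && ((map_mx (fun a : F16 => a ^+ 4) (GLval M))^T *m antidiag3 *m GLval M
           == antidiag3)%R].

(* Main.v *)
(* Regularity transports, between pairs (y, u) and (y', u') of the same isomorphism
   type, the number of g in G satisfying given equations in y, u, g.  Hence Z(G) is
   the set of elements of order dividing some p ^ m, and if G is not abelian every x
   with x ^ (p ^ m.+1) = 1 has all its commutators in V = {v | v ^ p = 1}.
   If x |-> x ^ (p ^ m) is multiplicative on these x (p odd, or m > 1, or they commute),
   commutation with y induces an endomorphism T of V, which kills <y> :&: V.  Regularity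
   of the pairs (y, u) with u in V outside <y> confines the image of T to <y> and makes
   T constant off <y>; this forces T = 0 when p is odd, and a comparison of T for y, y'
   and y y' rules out p = 2.
   Otherwise p = 2, G has exponent 4 and Z(G) = V.  If every commutator [x, y] lies in
   <x>, then G is Q_8.  If not, [x, -] maps G onto V for each noncentral x; counting the
   solutions of x ^ 2 = y ^ 2 in two ways gives |G| = |V| ^ 3, and a handshake argument
   on the square roots of a fixed involution, of which there are |V| + 1 modulo V, an odd
   number, gives |V| = 4.  The commutator table of G on suitable generators is then
   unique up to relabelling, and it is also that of G64. *)

Require Import Defs.
From mathcomp Require Import all_boot all_order all_algebra all_fingroup all_solvable all_field.
From mathcomp Require Import zify ring.
Set Implicit Arguments. Unset Strict Implicit. Unset Printing Implicit Defensive.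
Import GroupScope GRing.Theory.

(** * Transfer along isomorphisms of pairs *)

(** Equations between tuple entries are reified as syntax, so that one transfer lemma covers all the
    power and commutator conditions used below. *)
Inductive word :=
  | Var of nat | Unit | Exp of word & nat | Comm of word & word.

Fixpoint weval (gT : finGroupType) (s : seq gT) (w : word) : gT :=
  match w with
  | Var i => nth 1 s i
  | Unit => 1
  | Exp w1 n => weval s w1 ^+ n
  | Comm w1 w2 => [~ weval s w1, weval s w2]
  end.

(** The boolean is the truth value required of the equation; [false] encodes an inequation. *)
Definition literal := (bool * (word * word))%type.

Definition sat (gT : finGroupType) (s : seq gT) (ls : seq literal) : bool :=
  all (fun l => (weval s l.2.1 == weval s l.2.2) == l.1) ls.

Lemma weval_gen (gT : finGroupType) (s : seq gT) w :
  weval s w \in <<[set x in s]>>.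
Proof.
elim: w => [i||w H n|w1 H1 w2 H2] /=; last 3 first.
- exact: group1.
- exact: groupX.
- exact: groupR.
have [lt_i|ge_i] := ltnP i (size s); last by rewrite nth_default.
by rewrite mem_gen // inE mem_nth.
Qed.

(** The isomorphism commutes with evaluation of words; its injectivity makes inequations transfer as
    well as equations. *)
Lemma assign_iso_weval (gT : finGroupType) (xs ys : seq gT) w1 w2 :
  assign_iso xs ys ->
  (weval xs w1 == weval xs w2) = (weval ys w1 == weval ys w2).
Proof.
case=> eq_sz [f [fM f_inj _ fnth]].
pose H := <<[set x in xs]>>%G; pose fm := Morphism (fM : {in H &, _}).
have fE w : fm (weval xs w) = weval ys w.
  have inH w' : weval xs w' \in H by apply: weval_gen.
  elim: w => [i||u Hu n|u1 H1 u2 H2] /=.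
  - have [lt_i|ge_i] := ltnP i (size xs); first exact: fnth.
    by rewrite !nth_default -?eq_sz // -[f 1]/(fm 1) morph1.
  - exact: (morph1 fm).
  - by rewrite -[f _]/(fm _) morphX ?inH // Hu.
  - by rewrite -[f _]/(fm _) morphR ?inH // H1 H2.
rewrite -!fE; apply/eqP/eqP=> [->//|]; apply: f_inj; exact: weval_gen.
Qed.

Lemma assign_iso_sat (gT : finGroupType) (xs ys : seq gT) ls :
  assign_iso xs ys -> sat xs ls = sat ys ls.
Proof.
by move=> iso; apply: eq_all => l; rewrite (assign_iso_weval _ _ iso).
Qed.

Lemma gen_pair (gT : finGroupType) (y u : gT) :
  <<[set x in [:: y; u]]>> = <[y]> <*> <[u]>.
Proof. by rewrite !set_cons set_nil setU0 joing_idl joing_idr. Qed.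

Lemma dprod_cycles (gT : finGroupType) (y u : gT) :
  commute y u -> <[y]> :&: <[u]> = 1 -> <[y]> \x <[u]> = <[y]> <*> <[u]>.
Proof. by move=> cyu tiyu; apply: dprodEY => //; apply: cents_cycle. Qed.

(** Both pairs generate internal direct products of two cycles with matching orders, and the
    isomorphism is glued from maps of the factors. Every use of regularity below gets its
    isomorphism from here. *)
Lemma assign_iso_dprod (gT : finGroupType) (y u y' u' : gT) :
  commute y u -> commute y' u' ->
  <[y]> :&: <[u]> = 1 -> <[y']> :&: <[u']> = 1 ->
  #[y] = #[y'] -> #[u] = #[u'] -> assign_iso [:: y; u] [:: y'; u'].
Proof.
move=> cyu cyu' ti ti' oy ou; split=> //.
have dvy : #[y'] %| #[y] by rewrite oy.
have dvu : #[u'] %| #[u] by rewrite ou.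
have defH := dprod_cycles cyu ti.
have imy : eltm dvy @* <[y]> = <[y']> by rewrite morphim_cycle ?cycle_id //= eltm_id.
have imu : eltm dvu @* <[u]> = <[u']> by rewrite morphim_cycle ?cycle_id //= eltm_id.
have cim : eltm dvu @* <[u]> \subset 'C(eltm dvy @* <[y]>).
  by rewrite imu imy; apply: cents_cycle.
pose f := dprodm defH cim; exists f; rewrite gen_pair.
have finj : 'injm f.
  by rewrite injm_dprodm !injm_eltm oy ou !dvdnn imy imu ti' eqxx.
split.
- by move=> a b Ha Hb; rewrite /f morphM.
- by move=> a b Ha Hb; apply: (injmP finj).
- rewrite gen_pair -(dprod_cycles cyu' ti').
  have:= im_dprodm defH cim.
  rewrite imy imu morphimEdom => ->; rewrite dprodE //.
  exact: cents_cycle.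
case=> [|[|//]] _ /=.
- by rewrite [LHS]dprodmEl ?cycle_id // [LHS]eltm_id.
- by rewrite [LHS]dprodmEr ?cycle_id // [LHS]eltm_id.
Qed.

Section Transfer.

Variables (gT : finGroupType) (G : {group gT}).
Hypothesis regG : two_tuple_regular G.

Lemma reg_card (g1 g2 h1 h2 : gT) ls :
    g1 \in G -> g2 \in G -> h1 \in G -> h2 \in G ->
    assign_iso [:: g1; g2] [:: h1; h2] ->
  #|[set g in G | sat [:: g1; g2; g] ls]| = #|[set g in G | sat [:: h1; h2; g] ls]|.
Proof.
move=> Gg1 Gg2 Gh1 Gh2 /(regG Gg1 Gg2 Gh1 Gh2) [Psi [Psi_inj PsiG iso3]].
have <- : Psi @: [set g in G | sat [:: g1; g2; g] ls]
          = [set g in G | sat [:: h1; h2; g] ls].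
  apply/setP=> h; rewrite inE; apply/imsetP/andP.
    case=> g; rewrite inE => /andP[Gg sg] ->; rewrite -{1}PsiG imset_f //.
    by rewrite -(assign_iso_sat _ (iso3 g Gg)).
  case; rewrite -{1}PsiG => /imsetP[g Gg ->] sh; exists g => //.
  by rewrite inE Gg (assign_iso_sat _ (iso3 g Gg)).
rewrite card_in_imset // => a b; rewrite !inE => /andP[Ga _] /andP[Gb _].
exact: Psi_inj.
Qed.

Lemma reg_ex (g1 g2 h1 h2 : gT) ls :
    g1 \in G -> g2 \in G -> h1 \in G -> h2 \in G ->
    assign_iso [:: g1; g2] [:: h1; h2] ->
  forall g, g \in G -> sat [:: g1; g2; g] ls ->
  exists2 h, h \in G & sat [:: h1; h2; h] ls.
Proof.
move=> Gg1 Gg2 Gh1 Gh2 iso g Gg sg.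
have: 0 < #|[set h in G | sat [:: h1; h2; h] ls]|.
  by rewrite -(reg_card _ Gg1 Gg2 Gh1 Gh2 iso); apply/card_gt0P; exists g; rewrite inE Gg.
by case/card_gt0P=> h; rewrite inE => /andP[]; exists h.
Qed.

(** Padding with [1] lets regularity of pairs act on single elements. *)
Lemma assign_iso_order (x y : gT) : #[x] = #[y] -> assign_iso [:: x; 1] [:: y; 1].
Proof. by move=> oxy; apply: assign_iso_dprod; rewrite ?cycle1 ?setIg1 //; apply: commute1. Qed.

Lemma reg_ex1 (x y : gT) ls :
    x \in G -> y \in G -> #[x] = #[y] ->
  forall g, g \in G -> sat [:: x; 1; g] ls ->
  exists2 h, h \in G & sat [:: y; 1; h] ls.
Proof. by move=> Gx Gy /assign_iso_order iso; apply: reg_ex. Qed.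

End Transfer.

(** * The center and the elements just above it *)

Section PGroup.

Variables (p : nat) (gT : finGroupType) (G : {group gT}).
Hypotheses (p_pr : prime p) (pG : p.-group G) (regG : two_tuple_regular G).

Lemma p_elt_order x : x \in G -> exists k, #[x] = (p ^ k)%N.
Proof. by move=> Gx; have /p_natP[k ->] := mem_p_elt pG Gx; exists k. Qed.

(** Let p ^ m be the exponent of the center, attained at [z]. An element [x] of order dividing p ^ m
    has the order of a power of [z], which is central, and centrality transfers. *)
Lemma center_expP : exists m, {in G, forall x, (x \in 'Z(G)) = (x ^+ (p ^ m) == 1)}.
Proof.
have [z Zz ez] := exponent_witness (abelian_nil (center_abelian G)).
have Gz : z \in G by apply: subsetP (center_sub G) _ Zz.
have [m oz] := p_elt_order Gz; exists m => x Gx.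
apply/idP/eqP=> [Zx | xm1].
  by apply/eqP; rewrite -oz -ez -order_dvdn dvdn_exponent.
have [k ox] := p_elt_order Gx.
have le_km : k <= m.
  by rewrite -(dvdn_Pexp2l _ _ (prime_gt1 p_pr)) -ox order_dvdn xm1.
pose z' := z ^+ (p ^ (m - k)).
have oz' : #[z'] = #[x] by rewrite (orderXexp _ oz) subKn // ox.
have Zz' : z' \in 'Z(G) by rewrite groupX.
have Gz' : z' \in G by rewrite groupX.
apply/centerP; split=> // g Gg; apply/commgP; apply: contraT => ncxg.
have [|h Gh] := reg_ex1 (ls := [:: (false, (Comm (Var 0) (Var 2), Unit))]) regG
  Gx Gz' (esym oz') Gg; first by rewrite /sat /= (negPf ncxg).
rewrite /sat /= andbT; suff /commgP -> : commute z' h by [].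
by case/centerP: Zz' => _ /(_ h Gh).
Qed.

(** One element of order p is a p ^ n-th power of an element of maximal order p ^ n.+1, so by
    regularity all are; hence ['Ohm_1(G)] equals the last nontrivial ['Mho], which characterizes
    homocyclic groups. *)
Lemma reg_abelian_homocyclic : abelian G -> homocyclic G.
Proof.
move=> cGG; have [G1 | ntG] := eqVneq (G : {set gT}) 1.
  apply/(Ohm1_homocyclicP pG cGG).
  by rewrite (trivgP (subset_trans (Ohm_sub _ _) _)) ?(trivgP (subset_trans (Mho_sub _ _) _)) ?G1.
have [z Gz ez] := exponent_witness (abelian_nil cGG).
have [[|n] oz] := p_elt_order Gz.
  by case/eqP: ntG; apply/eqP; rewrite trivg_exponent ez oz expn0.
apply/(Ohm1_homocyclicP pG cGG); rewrite ez oz pfactorK //=.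
rewrite (OhmE 1 pG) (MhoE n pG); congr <<_>>; apply/setP=> u.
rewrite !inE expn1; apply/andP/imsetP=> [[Gu up1] | [g Gg ->]]; last first.
  by rewrite groupX // -expgM -expnSr -oz -ez -order_dvdn dvdn_exponent.
have [-> | ntu] := eqVneq u 1.
  by exists 1; rewrite ?group1 ?expg1n.
have ou : #[z ^+ (p ^ n)] = #[u].
  rewrite (orderXexp _ oz) subSn // subnn; apply/esym.
  by apply: nt_prime_order => //; apply/eqP.
have [|g Gg] := reg_ex1 (ls := [:: (true, (Exp (Var 2) (p ^ n), Var 0))]) regG
   (groupX (p ^ n) Gz) Gu ou Gz; first by rewrite /sat /= eqxx.
by rewrite /sat /= andbT => /eqP/eqP <-; exists g.
Qed.

Variable m : nat.
Hypothesis ZE : {in G, forall x, (x \in 'Z(G)) = (x ^+ (p ^ m) == 1)}.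
Hypothesis ncG : ~~ abelian G.

Let sZG : 'Z(G) \subset G := center_sub G.
Let nZG : G \subset 'N('Z(G)) := normal_norm (center_normal G).

Lemma center_commute x y : x \in 'Z(G) -> y \in G -> commute x y.
Proof. by case/centerP=> _ cx /cx. Qed.

Lemma center_commg x y : x \in 'Z(G) -> y \in G -> [~ x, y] = 1.
Proof. by move=> Zx Gy; apply/eqP/commgP/center_commute. Qed.

Lemma order_center_exp_gt0 : 0 < m.
Proof.
case: m ZE => // ZE0.
have ntG : G :!=: 1 by apply: contra ncG => /eqP ->; apply: abelian1.
have: 'Z(G) != 1 by rewrite center_nil_eq1 ?(pgroup_nil pG).
case/trivgPn=> z Zz; have:= ZE0 z (subsetP sZG _ Zz).
by rewrite Zz expn0 expg1 => <-.
Qed.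

(** A nontrivial central element of [G / 'Z(G)] lifts to an element of order above p ^ m; a suitable
    power has order p ^ m.+1 and is still central modulo the center. *)
Lemma exists_second_center :
  exists2 x, x \in G /\ #[x] = (p ^ m.+1)%N & forall g, g \in G -> [~ x, g] \in 'Z(G).
Proof.
have pQ : p.-group (G / 'Z(G)) by apply: quotient_pgroup.
have: 'Z(G / 'Z(G)) != 1.
  rewrite center_nil_eq1 ?(pgroup_nil pQ) // -subG1 quotient_sub1 //.
  by apply: contra ncG => sGZ; apply: abelianS sGZ (center_abelian G).
case/trivgPn=> _ /setIP[/morphimP[x Nx Gx ->] cx] ntx.
have [k ox] := p_elt_order Gx.
have lt_mk : m < k.
  rewrite ltnNge; apply: contra ntx => le_km; apply/eqP/coset_id.
  by rewrite ZE // -order_dvdn ox dvdn_exp2l.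
exists (x ^+ (p ^ (k - m.+1))).
  by split; [apply: groupX | rewrite (orderXexp _ ox) subKn].
move=> g Gg; have Ng := subsetP nZG g Gg.
have Nx' := groupX (p ^ (k - m.+1)) Nx.
apply: coset_idr; first by rewrite groupR.
rewrite morphR //; apply/eqP/commgP.
rewrite morphX //; apply/commute_sym/commuteX/commute_sym.
by apply: (centP cx); apply: mem_quotient.
Qed.

(** Elements of order p ^ m.+1 are interchangeable under regularity, and one of them has only
    central commutators; by [ZE] centrality is a power equation, so it transfers. *)
Lemma low_exp_commg x g :
  x \in G -> x ^+ (p ^ m.+1) = 1 -> g \in G -> [~ x, g] \in 'Z(G).
Proof.
move=> Gx xm1 Gg; have [Zx | nZx] := boolP (x \in 'Z(G)).
  by rewrite center_commg ?group1.
have ox : #[x] = (p ^ m.+1)%N.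
  have [k ox] := p_elt_order Gx; rewrite ox; congr (p ^ _)%N; apply/eqP.
  rewrite eqn_leq -(dvdn_Pexp2l _ _ (prime_gt1 p_pr)) -ox order_dvdn xm1 eqxx /=.
  rewrite ltnNge; apply: contra nZx => le_km.
  by rewrite ZE // -order_dvdn ox dvdn_exp2l.
have [x0 [Gx0 ox0] Zx0] := exists_second_center.
rewrite ZE ?groupR //; apply: contraT => nt.
have [|h Gh] := reg_ex1 (ls := [:: (false, (Exp (Comm (Var 0) (Var 2)) (p ^ m), Unit))]) regG
   Gx Gx0 (etrans ox (esym ox0)) Gg; first by rewrite /sat /= (negPf nt).
by rewrite /sat /= -(ZE (groupR Gx0 Gh)) Zx0.
Qed.

(** As [x, g] is central, its p-th power is [x ^ p, g], and x ^ p is central by [ZE]. *)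
Lemma low_exp_commg_exp x g :
  x \in G -> x ^+ (p ^ m.+1) = 1 -> g \in G -> [~ x, g] ^+ p = 1.
Proof.
move=> Gx xm1 Gg; have Zxg := low_exp_commg Gx xm1 Gg.
rewrite -commXg; last exact/commute_sym/center_commute.
apply: center_commg => //.
by rewrite ZE ?groupX // -expgM -expnS xm1.
Qed.

Lemma low_exp_commgM x y g : x \in G -> x ^+ (p ^ m.+1) = 1 -> y \in G -> g \in G ->
  [~ x * y, g] = [~ x, g] * [~ y, g].
Proof.
move=> Gx xm1 Gy Gg; rewrite commMgJ; congr (_ * _).
by apply/conjg_fixP/commgP/center_commute => //; apply: low_exp_commg.
Qed.

Lemma low_exp_commgMr x y g : x \in G -> x ^+ (p ^ m.+1) = 1 -> y \in G -> g \in G ->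
  [~ x, y * g] = [~ x, y] * [~ x, g].
Proof.
move=> Gx xm1 Gy Gg; rewrite commgMJ.
have /center_commute-> := low_exp_commg Gx xm1 Gg; last by rewrite groupJ ?groupR.
congr (_ * _).
by apply/conjg_fixP/commgP/center_commute => //; apply: low_exp_commg.
Qed.

End PGroup.

(** * The case of a multiplicative power map *)

Section PowerMorphism.

Variables (p : nat) (gT : finGroupType) (G : {group gT}).
Hypotheses (p_pr : prime p) (pG : p.-group G) (regG : two_tuple_regular G).
Variable m : nat.
Hypothesis ZE : {in G, forall x, (x \in 'Z(G)) = (x ^+ (p ^ m) == 1)}.
Hypothesis ncG : ~~ abelian G.

Let m_gt0 : 0 < m := order_center_exp_gt0 pG ZE ncG.

Lemma exp_p_center v : v \in G -> v ^+ p = 1 -> v \in 'Z(G).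
Proof. by move=> Gv vp1; rewrite ZE // -(prednK m_gt0) expnS expgM vp1 expg1n. Qed.

Lemma exp_p_order (v : gT) : v ^+ p = 1 -> v != 1 -> #[v] = p.
Proof. by move=> vp1 ntv; apply: nt_prime_order => //; apply/eqP. Qed.

Lemma exp_p_TI (y v : gT) : v ^+ p = 1 -> v \notin <[y]> -> <[y]> :&: <[v]> = 1.
Proof.
move=> vp1 nyv; have ntv : v != 1 by apply: contra nyv => /eqP->; rewrite group1.
by rewrite setIC; apply: prime_TIg; rewrite ?cycle_subG // -orderE exp_p_order.
Qed.

Lemma assign_iso_center y v v' : y \in G -> v \in G -> v' \in G -> v ^+ p = 1 -> v' ^+ p = 1 ->
  v \notin <[y]> -> v' \notin <[y]> -> assign_iso [:: y; v] [:: y; v'].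
Proof.
move=> Gy Gv Gv' vp vp' nyv nyv'.
have nt u : u \notin <[y]> -> u != 1 by apply: contra => /eqP->; rewrite group1.
apply: assign_iso_dprod => //; rewrite ?exp_p_TI //.
- by apply/commute_sym/(center_commute (exp_p_center Gv vp)).
- by apply/commute_sym/(center_commute (exp_p_center Gv' vp')).
- by rewrite !exp_p_order // nt.
Qed.

Lemma exp_p_root u : u \in G -> u ^+ p = 1 -> exists2 w, w \in G & w ^+ (p ^ m) = u.
Proof.
move=> Gu up1; have [-> | ntu] := eqVneq u 1.
  by exists 1; rewrite ?group1 ?expg1n.
have [x [Gx ox] _] := exists_second_center pG ZE ncG.
have ou : #[x ^+ (p ^ m)] = #[u].
  by rewrite (orderXexp _ ox) subSn // subnn exp_p_order.
have [|w Gw] := reg_ex1 (ls := [:: (true, (Exp (Var 2) (p ^ m), Var 0))]) regG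
  (groupX _ Gx) Gu ou Gx; first by rewrite /sat /= eqxx.
by rewrite /sat /= andbT => /eqP/eqP; exists w.
Qed.

(** A noncentral y has order above p ^ m, which the exponent [i + m] records: elements of <y> of
    order dividing p are then p ^ m-th powers inside <y>. *)
Lemma cycle_socle y : y \in G -> y \notin 'Z(G) ->
  exists i, [/\ #[y] = (p ^ (i + m).+1)%N, #[y ^+ (p ^ (i + m))] = p
    & forall u, u \in <[y]> -> u ^+ p = 1 -> exists t, u = y ^+ (p ^ (i + m) * t)].
Proof.
move=> Gy nZy; have [k oy] := p_elt_order pG Gy.
have lt_mk : m < k.
  rewrite ltnNge; apply: contra nZy => le_km.
  by rewrite ZE // -order_dvdn oy dvdn_exp2l.
exists (k - m.+1); have -> : (k - m.+1 + m)%N = k.-1 by rewrite -subn1; lia.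
have k_gt0 : 0 < k by apply: leq_ltn_trans lt_mk.
rewrite prednK //; split=> //.
  by rewrite (orderXexp _ oy) -subn1 subKn.
move=> _ /cycleP[j ->] /eqP; rewrite -expgM -order_dvdn oy -{1}(prednK k_gt0) expnSr.
by rewrite dvdn_pmul2r ?prime_gt0 // => /dvdnP[t ->]; exists t; rewrite mulnC.
Qed.

Hypothesis powM : forall x y, x \in G -> y \in G ->
  x ^+ (p ^ m.+1) = 1 -> y ^+ (p ^ m.+1) = 1 ->
  (x * y) ^+ (p ^ m) = x ^+ (p ^ m) * y ^+ (p ^ m).

Let low (x : gT) : x ^+ (p ^ m) ^+ p = x ^+ (p ^ m.+1).
Proof. by rewrite -expgM expnSr. Qed.

(** This makes T well defined: T sends u to [w, y] for any w with w ^ (p ^ m) = u. Multiplicativity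
    of the power map puts the quotient of two such roots in the center. *)
Lemma commg_root_eq w w' y : w \in G -> w' \in G -> y \in G ->
  w ^+ (p ^ m.+1) = 1 -> w ^+ (p ^ m) = w' ^+ (p ^ m) -> [~ w, y] = [~ w', y].
Proof.
move=> Gw Gw' Gy w1 eqw.
have w1' : w' ^+ (p ^ m.+1) = 1 by rewrite -low -eqw low.
have Zz : w^-1 * w' \in 'Z(G).
  rewrite ZE ?groupM ?groupV // powM ?groupV // ?expgVn ?w1 ?invg1 //.
  by rewrite eqw mulVg.
rewrite -[w'](mulKVg w) (low_exp_commgM p_pr pG regG ZE ncG) ?groupM ?groupV //.
by rewrite (center_commg Zz Gy) mulg1.
Qed.

(** T kills u in <y>, because u then has a root inside <y>, which commutes with y. *)
Lemma commg_root_in w y : w \in G -> y \in G ->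
  w ^+ (p ^ m.+1) = 1 -> w ^+ (p ^ m) \in <[y]> -> [~ w, y] = 1.
Proof.
move=> Gw Gy w1 wy; have [Zy | nZy] := boolP (y \in 'Z(G)).
  by apply/eqP/commgP/commute_sym/(center_commute Zy Gw).
have [i [oy _ /(_ _ wy)[|t def_u]]] := cycle_socle Gy nZy; first by rewrite low.
rewrite (@commg_root_eq _ (y ^+ (p ^ i * t))) ?groupX //; last first.
  by rewrite def_u -expgM expnD mulnAC.
by apply/eqP/commgP/commute_sym/commuteX.
Qed.

(** If a value v of T is outside <y>, regularity of (y, v) puts all such elements in the image, so T
    is onto V and, V being finite, injective; but T kills an element of order p in <y>. *)
Lemma commg_root_cycle w y : w \in G -> y \in G -> w ^+ (p ^ m.+1) = 1 -> [~ w, y] \in <[y]>.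
Proof.
move=> Gw Gy w1; apply: contraT => nyv.
have nZy : y \notin 'Z(G).
  apply: contra nyv => Zy; rewrite (_ : [~ w, y] = 1) ?group1 //.
  by apply/eqP/commgP/commute_sym/(center_commute Zy Gw).
set v := [~ w, y] in nyv; have Gv : v \in G by rewrite groupR.
have vp1 : v ^+ p = 1 by apply: (low_exp_commg_exp p_pr pG regG ZE ncG).
have out v' : v' \in G -> v' ^+ p = 1 -> v' \notin <[y]> ->
    exists2 w', w' \in G & w' ^+ (p ^ m.+1) = 1 /\ [~ w', y] = v'.
  move=> Gv' vp1' nyv'.
  have [|w' Gw'] := reg_ex (ls := [:: (true, (Exp (Var 2) (p ^ m.+1), Unit));
      (true, (Comm (Var 2) (Var 0), Var 1))]) regG Gy Gv Gy Gv'
      (assign_iso_center Gy Gv Gv' vp1 vp1' nyv nyv') Gw; first by rewrite /sat /= w1 !eqxx.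
  by rewrite /sat /= andbT => /andP[/eqP/eqP w1' /eqP/eqP vw']; exists w'.
have all_v v' : v' \in G -> v' ^+ p = 1 ->
    exists2 w', w' \in G & w' ^+ (p ^ m.+1) = 1 /\ [~ w', y] = v'.
  move=> Gv' vp1'; have [yv' | nyv'] := boolP (v' \in <[y]>); last exact: out.
  have Zv := exp_p_center Gv vp1.
  (* Here v' * v^-1 is outside <y>, so v' is a product of two values of T. *)
  have [||| w2 Gw2 [w21 vw2]] := out (v' * v^-1).
  - by rewrite groupM ?groupV.
  - rewrite expgMn ?expgVn ?vp1 ?vp1' ?invg1 ?mulg1 //.
    exact/commute_sym/(center_commute (groupVr Zv) Gv').
  - by apply: contra nyv => yv; rewrite -groupV -(groupMl _ yv') .
  exists (w2 * w); first exact: groupM.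
  split; last by rewrite (low_exp_commgM p_pr pG regG ZE ncG) // vw2 mulgKV.
  rewrite -low powM // expgMn ?low ?w1 ?w21 ?mulg1 //.
  by apply: (center_commute (exp_p_center (groupX _ Gw2) _) (groupX _ Gw)); rewrite low.
pose V := [set u in G | u ^+ p == 1].
(* The default 1 is never reached for u in V, by [exp_p_root]. *)
pose r u := odflt 1 [pick w in G | w ^+ (p ^ m) == u].
have rP u : u \in V -> r u \in G /\ r u ^+ (p ^ m) = u.
  rewrite inE => /andP[Gu /eqP up1]; rewrite /r; case: pickP => [x /andP[Gx /eqP] //| no_w].
  by have [x Gx xu] := exp_p_root Gu up1; have:= no_w x; rewrite /= Gx xu eqxx.
pose f u := [~ r u, y].
have sVf : V \subset f @: V.
  apply/subsetP=> v'; rewrite inE => /andP[Gv' /eqP vp1'].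
  have [w' Gw' [w1' <-]] := all_v v' Gv' vp1'.
  have Vu : w' ^+ (p ^ m) \in V by rewrite inE groupX //= low w1'.
  apply/imsetP; exists (w' ^+ (p ^ m)) => //.
  by have [Gr ru] := rP _ Vu; apply: commg_root_eq.
have f_inj : {in V &, injective f}.
  by apply/imset_injP; rewrite eqn_leq leq_imset_card subset_leq_card.
have [i [oy oy0 _]] := cycle_socle Gy nZy.
set y0 := y ^+ _ in oy0.
have Vy0 : y0 \in V by rewrite inE groupX //= -oy0 expg_order.
have V1 : 1 \in V by rewrite inE group1 expg1n eqxx.
have f1 u : u \in V -> u \in <[y]> -> f u = 1.
  move=> Vu yu; have [Gr ru] := rP u Vu; apply: commg_root_in; rewrite ?ru //.
  by rewrite -low ru; move: Vu; rewrite inE => /andP[_ /eqP].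
have y01 : y0 = 1.
  by apply: f_inj; rewrite ?f1 ?group1 // mem_cycle.
by move: (prime_gt1 p_pr); rewrite -oy0 y01 order1.
Qed.

(** The equation [w, y] = y ^ j mentions only y on the right, so regularity of (y, u) carries it to
    a root of any u' outside <y>, and all roots of u' have the same commutator with y. *)
Lemma commg_root_const w w' y : w \in G -> w' \in G -> y \in G ->
  w ^+ (p ^ m.+1) = 1 -> w' ^+ (p ^ m.+1) = 1 ->
  w ^+ (p ^ m) \notin <[y]> -> w' ^+ (p ^ m) \notin <[y]> -> [~ w, y] = [~ w', y].
Proof.
move=> Gw Gw' Gy w1 w1' nyu nyu'; have u1 := low w; have u1' := low w'.
rewrite w1 in u1; rewrite w1' in u1'; have /cycleP[j dj] := commg_root_cycle Gw Gy w1.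
have [|h Gh] := reg_ex (ls := [:: (true, (Exp (Var 2) (p ^ m), Var 1));
    (true, (Comm (Var 2) (Var 0), Exp (Var 0) j))]) regG Gy (groupX _ Gw) Gy (groupX _ Gw')
    (assign_iso_center Gy (groupX _ Gw) (groupX _ Gw') u1 u1' nyu nyu') Gw.
  by rewrite /sat /= dj !eqxx.
rewrite /sat /= andbT => /andP[/eqP/eqP hu /eqP/eqP hj].
by rewrite dj -hj; apply: commg_root_eq => //; rewrite -low hu low.
Qed.

(** If u is outside <y>, so is u ^ 2, whence T u = T (u ^ 2) = (T u) ^ 2 and T u = 1. An element of
    order p ^ m.+1 would thus be central. *)
Lemma powM_odd_False : odd p -> False.
Proof.
move=> p_odd; have [x [Gx ox] _] := exists_second_center pG ZE ncG.
have x1 : x ^+ (p ^ m.+1) = 1 by rewrite -ox expg_order.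
have: x \in 'Z(G).
  apply/centerP; split=> // y Gy; apply/commgP/eqP.
  have [yu | nyu] := boolP (x ^+ (p ^ m) \in <[y]>); first exact: commg_root_in.
  have x21 : (x ^+ 2) ^+ (p ^ m.+1) = 1 by rewrite expgAC x1 expg1n.
  have nyu2 : (x ^+ 2) ^+ (p ^ m) \notin <[y]>.
    have u1 : x ^+ (p ^ m) ^+ p = 1 by rewrite low.
    apply: contra nyu => yu2.
    (* The exponent (p + 1) / 2 inverts 2 modulo p. *)
    suff -> : x ^+ (p ^ m) = ((x ^+ 2) ^+ (p ^ m)) ^+ (p.+1)./2 by apply: groupX.
    rewrite (expgAC x 2) -[RHS]expgM mul2n halfK /= p_odd subn0 expgSr.
    by rewrite u1 mul1g.
  have:= commg_root_const Gx (groupX 2 Gx) Gy x1 x21 nyu nyu2.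
  rewrite expgS expg1 (low_exp_commgM p_pr pG regG ZE ncG) // => /eqP.
  by rewrite -{1}[[~ x, y]]mulg1 (inj_eq (mulgI _)) eq_sym => /eqP.
by rewrite ZE // -order_dvdn ox dvdn_Pexp2l ?prime_gt1 // ltnn.
Qed.

Lemma socle_two y i u : p = 2 -> y \in G -> #[y] = (p ^ (i + m).+1)%N ->
  u \in <[y]> -> u ^+ p = 1 -> u != 1 -> u = y ^+ (p ^ (i + m)).
Proof.
move=> p2 Gy oy yu up1 ntu.
have oy0 : #[y ^+ (p ^ (i + m))] = 2 by rewrite (orderXexp _ oy) subSnn p2.
have: <[u]> = <[y ^+ (p ^ (i + m))]>.
  apply/eqP; rewrite (eq_subG_cyclic (cycle_cyclic y)) ?cycle_subG ?mem_cycle //.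
  by rewrite -!orderE oy0 exp_p_order // p2.
move/setP/(_ u); rewrite cycle_id (cycle2g oy0) !inE (negPf ntu) /=.
by move/esym/eqP.
Qed.

(** The constant value of T off <y> is nontrivial, squares to 1 and lies in <y>, so it is the
    involution of <y>. *)
Lemma commg_root_two y i w1 w : p = 2 -> y \in G -> #[y] = (p ^ (i + m).+1)%N ->
  w1 \in G -> w1 ^+ (p ^ m.+1) = 1 -> [~ w1, y] != 1 ->
  w \in G -> w ^+ (p ^ m.+1) = 1 -> w ^+ (p ^ m) \notin <[y]> ->
  [~ w, y] = y ^+ (p ^ (i + m)).
Proof.
move=> p2 Gy oy Gw1 w11 nt1 Gw w_1 nyu.
have nyu1 : w1 ^+ (p ^ m) \notin <[y]>.
  by apply: contra nt1 => yu1; rewrite commg_root_in.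
rewrite -(commg_root_const Gw1 Gw Gy w11 w_1 nyu1 nyu).
apply: (socle_two p2 Gy oy) => //; first exact: commg_root_cycle.
exact: (low_exp_commg_exp p_pr pG regG ZE ncG).
Qed.

(** Take y, y' whose cycles have distinct involutions a, b. For a root w of the involution e of <y
    y'>, [w, y * y'] = 1; yet [w, y] * [w, y'] is b, a or a * b according as e is a, b or
    neither. *)
Lemma powM_two_False : p = 2 -> False.
Proof.
move=> p2; have [x [Gx ox] _] := exists_second_center pG ZE ncG.
have x1 : x ^+ (p ^ m.+1) = 1 by rewrite -ox expg_order.
have nZx : x \notin 'Z(G) by rewrite ZE // -order_dvdn ox dvdn_Pexp2l ?prime_gt1 // ltnn.
have [y Gy ntxy] : exists2 y, y \in G & [~ x, y] != 1.
  apply/exists_inP; apply: contraR nZx; rewrite negb_exists_in => /forall_inP cx.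
  by apply/centerP; split=> // y Gy; apply/commgP; rewrite -[_ == _]negbK cx.
have nZy : y \notin 'Z(G).
  by apply: contra ntxy => /center_commg cy; apply/commgP/commute_sym/commgP; rewrite cy.
have [i [oy oa _]] := cycle_socle Gy nZy; set a := y ^+ _ in oa.
pose b := x ^+ (p ^ m).
have Gb : b \in G by rewrite groupX.
have bp1 : b ^+ p = 1 by rewrite low.
have nyb : b \notin <[y]> by apply: contra ntxy => yb; rewrite commg_root_in.
have ob : #[b] = p by rewrite (orderXexp _ ox) subSnn.
have ntb : b != 1 by rewrite -order_gt1 ob prime_gt1.
have nta : a != 1 by rewrite -order_gt1 oa prime_gt1.
have Ga : a \in G by rewrite groupX.
have ya : a \in <[y]> by apply: mem_cycle.
have nab : a != b by apply: contra nyb => /eqP <-.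
have [|y' Gy'] := reg_ex1 (ls := [:: (true, (Exp (Var 2) (p ^ (i + m)), Var 0))]) regG
  Ga Gb (etrans oa (esym ob)) Gy; first by rewrite /sat /= eqxx.
rewrite /sat /= andbT => /eqP/eqP def_b.
have oy' : #[y'] = (p ^ (i + m).+1)%N.
  by rewrite expnSr; apply: orderXpfactor => //; rewrite def_b.
(* The element w1 shows that T for y' is nontrivial too. *)
have [|w1 Gw1] := reg_ex1 (ls := [:: (false, (Comm (Var 2) (Var 0), Unit));
    (true, (Exp (Var 2) (p ^ m.+1), Unit))]) regG Gy Gy' (etrans oy (esym oy')) Gx.
  by rewrite /sat /= (negPf ntxy) x1 !eqxx.
rewrite /sat /= andbT eqbF_neg => /andP[nt1 /eqP/eqP w11].
have y'b : b \in <[y']> by rewrite -def_b mem_cycle.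
have xy' : [~ x, y'] = 1 by apply: commg_root_in.
have cMr w : w \in G -> w ^+ (p ^ m.+1) = 1 -> [~ w, y * y'] = [~ w, y] * [~ w, y'].
  by move=> Gw w_1; rewrite (low_exp_commgMr p_pr pG regG ZE ncG).
have Gyy' : y * y' \in G by rewrite groupM.
have nZyy' : y * y' \notin 'Z(G).
  apply: contra ntxy => /center_commg cy.
  have: [~ x, y * y'] = 1 by apply/eqP/commgP/commute_sym/commgP; rewrite cy.
  by rewrite cMr // xy' mulg1 => ->.
have [k [oyy oe _]] := cycle_socle Gyy' nZyy'; set e := (y * y') ^+ _ in oe.
have Ge : e \in G by rewrite groupX.
have ep1 : e ^+ p = 1 by rewrite -oe expg_order.
have nte : e != 1 by rewrite -order_gt1 oe prime_gt1.
have [w Gw we] := exp_p_root Ge ep1.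
have w_1 : w ^+ (p ^ m.+1) = 1 by rewrite -low we.
have: [~ w, y * y'] = 1 by apply: commg_root_in; rewrite // we mem_cycle.
rewrite cMr // => /eqP; apply/negP.
have [ye | nye] := boolP (e \in <[y]>).
  rewrite (commg_root_in _ _ _ (_ : _ \in <[y]>)) ?we // mul1g.
  rewrite (commg_root_two p2 Gy' oy' Gw1 w11 nt1 Gw w_1) ?def_b // we.
  apply/negP=> y'e; case/eqP: nab.
  rewrite -def_b -(socle_two p2 Gy' oy' y'e ep1 nte).
  exact/esym/(socle_two p2 Gy oy ye ep1 nte).
rewrite (commg_root_two p2 Gy oy Gx x1 ntxy Gw w_1) ?we // -/a.
have [y'e | ny'e] := boolP (e \in <[y']>).
  by rewrite (commg_root_in _ _ _ (_ : _ \in <[y']>)) ?we // mulg1.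
rewrite (commg_root_two p2 Gy' oy' Gw1 w11 nt1 Gw w_1) ?we // def_b.
apply: contra nab; rewrite -eq_invg_mul => /eqP <-.
by rewrite eq_sym eq_invg_mul -[a * a]/(a ^+ 2) -p2 -oa expg_order.
Qed.

End PowerMorphism.

(** * Reduction to exponent four *)

Lemma dvdn_bin2_expn p m : prime p -> 0 < m -> odd p || (1 < m) -> p %| 'C(p ^ m, 2).
Proof.
move=> p_pr m_gt0 odd_or; have pm_gt0 : 0 < p ^ m by rewrite expn_gt0 prime_gt0.
have [p_odd | p_even] := boolP (odd p).
  have: p %| 'C(p ^ m, 2) * 2.
    by rewrite mulnC -mul_bin_diag bin1 dvdn_mulr // dvdn_exp.
  by rewrite Gauss_dvdl // coprimen2.
have p2 : p = 2 by case: (even_prime p_pr) p_even => // ->.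
rewrite (negPf p_even) /= in odd_or.
rewrite bin2 p2 -(prednK m_gt0) expnS -mulnA mul2n doubleK dvdn_mulr //.
by rewrite dvdn_exp // -ltnS prednK.
Qed.

(** On [W] the power map fails to be multiplicative by [y, x] ^ 'C(p ^ m, 2), which is trivial if p
    divides the binomial or [W] is commutative. What survives is p = 2, m = 1 and two noncommuting
    elements of order 4; by regularity every element of order 4 then fails to commute with some h
    such that h ^ 4 = 1. *)
Lemma nonabelian_reg_exp4 (p : nat) (gT : finGroupType) (G : {group gT}) :
    prime p -> p.-group G -> two_tuple_regular G -> ~~ abelian G ->
  [/\ p = 2, {in G, forall x, (x \in 'Z(G)) = (x ^+ 2 == 1)}
    & {in G, forall x, x ^+ 4 = 1}].
Proof.
move=> p_pr pG regG ncG; have [m ZE] := center_expP p_pr pG regG.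
have m_gt0 := order_center_exp_gt0 pG ZE ncG.
pose W := [set x in G | x ^+ (p ^ m.+1) == 1].
have powE x y : x \in W -> y \in W ->
    (x * y) ^+ (p ^ m) = x ^+ (p ^ m) * y ^+ (p ^ m) * [~ y, x] ^+ 'C(p ^ m, 2).
  rewrite !inE => /andP[Gx /eqP x1] /andP[Gy /eqP y1].
  have Zyx := low_exp_commg p_pr pG regG ZE ncG Gy y1 Gx.
  by apply: expMg_Rmul; apply/commute_sym/(center_commute Zyx).
have powM_False : (forall x y, x \in W -> y \in W -> [~ y, x] ^+ 'C(p ^ m, 2) = 1) -> False.
  move=> bin1.
  have powM x y : x \in G -> y \in G -> x ^+ (p ^ m.+1) = 1 -> y ^+ (p ^ m.+1) = 1 ->
      (x * y) ^+ (p ^ m) = x ^+ (p ^ m) * y ^+ (p ^ m).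
    move=> Gx Gy x1 y1; have Wx : x \in W by rewrite inE Gx x1 /=.
    have Wy : y \in W by rewrite inE Gy y1 /=.
    by rewrite powE // bin1 // mulg1.
  case: (even_prime p_pr) => [p2 | p_odd].
    exact: (powM_two_False p_pr pG regG ZE ncG powM p2).
  exact: (powM_odd_False p_pr pG regG ZE ncG powM p_odd).
have [good | ] := boolP (odd p || (1 < m)).
  case: powM_False => x y; rewrite !inE => /andP[Gx /eqP x1] /andP[Gy /eqP y1].
  have /dvdnP[k ->] := dvdn_bin2_expn p_pr m_gt0 good.
  by rewrite mulnC expgM (low_exp_commg_exp p_pr pG regG ZE ncG) ?expg1n.
rewrite negb_or -leqNgt => /andP[p_even m_le1].
have p2 : p = 2 by case: (even_prime p_pr) p_even => // ->.
have m1 : m = 1%N by apply/eqP; rewrite eqn_leq m_le1.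
subst p m; clear m_gt0 m_le1 p_even.
have [w0 Ww0 [w1 Ww1 nt01]] : exists2 w0, w0 \in W & exists2 w1, w1 \in W & [~ w0, w1] != 1.
  have [/exists_inP[w0 Ww0 /exists_inP[w1 Ww1 nt]] | no] :=
    boolP [exists w0 in W, exists w1 in W, [~ w0, w1] != 1].
    by exists w0 => //; exists w1.
  case: powM_False => x y Wx Wy; move: no; rewrite negb_exists_in => /forall_inP/(_ y Wy).
  by rewrite negb_exists_in => /forall_inP/(_ x Wx)/negPn/eqP->; rewrite expg1n.
move: Ww0 Ww1; rewrite !inE => /andP[Gw0 /eqP w01] /andP[Gw1 /eqP w11].
have ord4 x : x ^+ (2 ^ 2) = 1 -> x ^+ 2 != 1 -> #[x] = 4.
  move=> x41 nx2; have ox2 : #[x ^+ 2] = 2.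
    by apply: exp_p_order => //; rewrite -expgM.
  by rewrite (orderXpfactor (k := 1) ox2).
have ncW x : x \in G -> x ^+ (2 ^ 2) = 1 -> x ^+ 2 != 1 ->
    exists2 h, h \in G & h ^+ 4 = 1 /\ [~ x, h] != 1.
  move=> Gx x1 ntx.
  have ow0 : #[w0] = #[x].
    rewrite !ord4 //; apply: contra nt01 => w02; rewrite (center_commg (G := G)) //.
    by rewrite ZE.
  have [|h Gh] := reg_ex1 (ls := [:: (false, (Comm (Var 0) (Var 2), Unit));
    (true, (Exp (Var 2) 4, Unit))]) regG Gw0 Gx ow0 Gw1.
    by rewrite /sat /= (negPf nt01) w11 !eqxx.
  by rewrite /sat /= andbT eqbF_neg => /andP[nt /eqP/eqP h1]; exists h.
split=> // y Gy; apply/eqP; apply: contraT => nty.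
have [k oy] := p_elt_order pG Gy.
have gt_k2 : 2 < k.
  rewrite ltnNge; apply: contra nty => le_k2.
  by rewrite -order_dvdn oy (dvdn_exp2l 2 le_k2).
(* For y of order at least 8, z has order 4 and is a power of y ^ 2, so it commutes with every such
   h: [h, y ^ 2] = [h, y] ^ 2 = 1. *)
pose z := y ^+ (2 ^ (k - 2)).
have oz : #[z] = 4 by rewrite (orderXexp _ oy) subKn // ltnW.
have [|||h Gh [h1 ]] := ncW z.
- by rewrite groupX.
- by rewrite -[(2 ^ 2)%N]oz expg_order.
- by rewrite -order_dvdn oz.
case/negP; apply/commgP/commute_sym.
rewrite /z -(subnSK gt_k2) expnS expgM; apply/commuteX/commgP.
rewrite (expgS y 1) expg1 (low_exp_commgMr p_pr pG regG ZE ncG) //.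
by apply/eqP; apply: (low_exp_commg_exp p_pr pG regG ZE ncG).
Qed.

(** * Counting *)

Lemma card_fibers (aT rT : finType) (A : {set aT}) (B : {set rT}) (f : aT -> rT) :
  {in A, forall x, f x \in B} -> #|A| = \sum_(v in B) #|[set x in A | f x == v]|.
Proof.
move=> AB; rewrite -sum1_card (partition_big f (mem B)) //=.
apply: eq_bigr => v _; rewrite -sum1_card; apply: eq_bigl => x; by rewrite inE.
Qed.

Lemma card_sum_nat (T : finType) (A : {set T}) (P : pred T) :
  #|[set x in A | P x]| = \sum_(x in A) P x.
Proof.
rewrite -sum1_card big_mkcond [RHS]big_mkcond; apply: eq_bigr => x _.
by rewrite inE; case: (x \in A); case: (P x).
Qed.

(** An arbitrary total order orients the edges; [S] counts each edge once and the degree sum counts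
    it twice. *)
Lemma handshake (T : finType) (A : {set T}) (e : rel T) :
  symmetric e -> irreflexive e -> 2 %| \sum_(x in A) #|[set y in A | e x y]|.
Proof.
move=> e_sym e_irr; pose lt (x y : T) := enum_rank x < enum_rank y.
pose S := \sum_(x in A) \sum_(y in A) (e x y && lt x y : nat).
suff -> : \sum_(x in A) #|[set y in A | e x y]| = (S + S)%N by rewrite addnn -mul2n dvdn_mulr.
rewrite {2}/S exchange_big /= -big_split /=; apply: eq_bigr => x _.
rewrite card_sum_nat -big_split /=; apply: eq_bigr => y _.
rewrite e_sym; case exy: (e y x) => //=; rewrite /lt.
case: (ltngtP (enum_rank x) (enum_rank y)) => // /val_inj/enum_rank_inj eq_xy.
by rewrite eq_xy e_irr in exy.
Qed.

(** The solution set is a union of cosets of [K], so solutions can be counted modulo [K] on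
    representatives. *)
Lemma card_quotient_pred (gT : finGroupType) (G K : {group gT}) (P : pred gT) :
  K <| G -> {in G & K, forall g z, P (g * z) = P g} ->
  #|[set g in G | P g]| = (#|K| * #|[set A in G / K | P (repr A)]|)%N.
Proof.
move=> nKG PK; have [sKG nKG'] := andP nKG.
have PE g : g \in G -> P (repr (coset K g)) = P g.
  move=> Gg; have Ng := subsetP nKG' g Gg.
  have: repr (coset K g) \in coset K g by apply: mem_repr_coset.
  rewrite val_coset // norm_rlcoset // => /lcosetP[z Kz ->]; exact: PK.
rewrite (@card_fibers _ _ _ [set A in G / K | P (repr A)] (coset K)); last first.
  by move=> g; rewrite !inE => /andP[Gg Pg]; rewrite mem_quotient ?PE.
rewrite (eq_bigr (fun => #|K|)) ?sum_nat_const 1?mulnC // => A.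
rewrite inE => /andP[/morphimP[h Nh Gh ->] Ph].
rewrite -(card_rcoset K h); apply: eq_card => g; rewrite !inE.
apply/andP/idP=> [[/andP[Gg _] /eqP eq_gh] | /rcosetP[k Kk ->]].
  by apply/(rcoset_kercosetP _ Nh); first exact: subsetP nKG' g Gg.
have Gk : k \in G by apply: (subsetP sKG).
have eq_kh : coset K (k * h) = coset K h.
  by apply/(rcoset_kercosetP _ Nh); rewrite ?groupM ?mem_rcoset ?mulgK // (subsetP nKG').
by rewrite eq_kh groupM //= -PE ?groupM // eq_kh Ph.
Qed.

Lemma repr_quotient_mem (gT : finGroupType) (G K : {group gT}) A :
  K <| G -> A \in G / K -> repr A \in G.
Proof.
move=> nKG QA; rewrite -(quotientGK nKG); apply: mem_morphpre; first exact: repr_coset_norm.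
by rewrite /= coset_reprK.
Qed.

Lemma ltn_double_sub2 n : 4 < n -> n < (n - 2) * 2.
Proof. lia. Qed.

(** Relations of a polycyclic presentation of G_64, with e1 ^ 2 and e2 ^ 2 in the role of a basis of
    the center. The last two fields supply the centrality relations that the other fields do not
    force. *)
Record suzuki_gens (gT : finGroupType) (e1 e2 e3 e4 : gT) : Prop := SuzukiGens {
  suz_sqr3 : e3 ^+ 2 = e1 ^+ 2;
  suz_sqr4 : e4 ^+ 2 = e2 ^+ 2;
  suz_comm12 : [~ e1, e2] = 1;
  suz_comm34 : [~ e3, e4] = 1;
  suz_comm13 : [~ e1, e3] = e2 ^+ 2;
  suz_comm14 : [~ e1, e4] = e1 ^+ 2;
  suz_comm23 : [~ e2, e3] = e1 ^+ 2;
  suz_comm24 : [~ e2, e4] = e1 ^+ 2 * e2 ^+ 2;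
  suz_exp1 : (e1 ^+ 2) ^+ 2 = 1;
  suz_exp2 : (e2 ^+ 2) ^+ 2 = 1;
  suz_cent14 : [~ e1 ^+ 2, e4] = 1;
  suz_cent23 : [~ e2 ^+ 2, e3] = 1
}.

(* [(r, s)] stands for [a ^+ r * b ^+ s] in the Klein four-group <a, b>; the
   [p_kl] are the commutators of x, y with x', y', where x, x' square to a and
   y, y' square to b.  The test says that no commutator of a nontrivial
   [x ^+ i * y ^+ j] with a nontrivial [x' ^+ k * y' ^+ l] is trivial or equal to
   the product of their squares. *)
Definition suzuki_table (r13 s13 r14 s14 r23 s23 r24 s24 : bool) : bool :=
  let bools := [:: true; false] in
  all (fun i => all (fun j => all (fun k => all (fun l =>
    let r := ((r13 && k) (+) (r14 && l)) && i (+) ((r23 && k) (+) (r24 && l)) && j in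
    let s := ((s13 && k) (+) (s14 && l)) && i (+) ((s23 && k) (+) (s24 && l)) && j in
    (i || j) && (k || l) ==> (r || s) && ((r != i (+) k) || (s != j (+) l)))
  bools) bools) bools) bools.

(** All 256 tables are enumerated. The two survivors are exchanged by swapping a with b, x with y
    and x' with y'. *)
Lemma suzuki_tableP r13 s13 r14 s14 r23 s23 r24 s24 :
  suzuki_table r13 s13 r14 s14 r23 s23 r24 s24 ->
  [:: r13; s13; r14; s14; r23; s23; r24; s24] =
    [:: false; true; true; false; true; false; true; true] \/
  [:: r13; s13; r14; s14; r23; s23; r24; s24] =
    [:: true; true; false; true; false; true; true; false].
Proof.
by case: r13; case: s13; case: r14; case: s14; case: r23; case: s23; case: r24; case: s24;
   move=> // _; (left; reflexivity) || (right; reflexivity).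
Qed.

(** * Exponent four *)

Section ExponentFour.

Variables (gT : finGroupType) (G : {group gT}).
Hypotheses (pG : 2.-group G) (regG : two_tuple_regular G) (ncG : ~~ abelian G).
Hypothesis ZE : {in G, forall x, (x \in 'Z(G)) = (x ^+ 2 == 1)}.
Hypothesis E4 : {in G, forall x, x ^+ 4 = 1}.

Let pr2 : prime 2 := isT.
Let ZE1 : {in G, forall x, (x \in 'Z(G)) = (x ^+ (2 ^ 1) == 1)} := ZE.

Lemma commute_commg (x y : gT) : commute x y -> [~ x, y] = 1.
Proof. by move/commgP/eqP. Qed.

Lemma sqr_center x : x \in G -> x ^+ 2 \in 'Z(G).
Proof. by move=> Gx; rewrite ZE ?groupX // -expgM E4. Qed.

Lemma commg_center x y : x \in G -> y \in G -> [~ x, y] \in 'Z(G).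
Proof. by move=> Gx Gy; apply: (low_exp_commg pr2 pG regG ZE1 ncG); rewrite ?E4. Qed.

Lemma center_sqr x : x \in 'Z(G) -> x ^+ 2 = 1.
Proof. by move=> Zx; apply/eqP; rewrite -ZE // (subsetP (center_sub G)). Qed.

Lemma center_mulK x : x \in 'Z(G) -> x * x = 1.
Proof. exact: center_sqr. Qed.

Lemma center_inv x : x \in 'Z(G) -> x^-1 = x.
Proof. by move/center_mulK/eqP; rewrite -eq_invg_mul => /eqP. Qed.

Lemma class2_commMl x y g : x \in G -> y \in G -> g \in G ->
  [~ x * y, g] = [~ x, g] * [~ y, g].
Proof. by move=> Gx Gy Gg; apply: (low_exp_commgM pr2 pG regG ZE1 ncG); rewrite ?E4. Qed.

Lemma class2_commMr x y g : x \in G -> y \in G -> g \in G ->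
  [~ x, y * g] = [~ x, y] * [~ x, g].
Proof. by move=> Gx Gy Gg; apply: (low_exp_commgMr pr2 pG regG ZE1 ncG); rewrite ?E4. Qed.

Lemma class2_comm_sym x y : x \in G -> y \in G -> [~ y, x] = [~ x, y].
Proof. by move=> Gx Gy; rewrite -invg_comm center_inv ?commg_center. Qed.

Lemma class2_sqrM x y : x \in G -> y \in G ->
  (x * y) ^+ 2 = x ^+ 2 * y ^+ 2 * [~ x, y].
Proof.
move=> Gx Gy; have Zyx := commg_center Gy Gx.
rewrite expMg_Rmul; first by rewrite expg1 class2_comm_sym.
  exact/commute_sym/(center_commute Zyx).
exact/commute_sym/(center_commute Zyx).
Qed.

Lemma noncentral_order x : x \in G -> x \notin 'Z(G) -> #[x] = 4.
Proof.
move=> Gx; rewrite ZE // => nt; have ox2 : #[x ^+ 2] = 2.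
  by apply: exp_p_order => //; rewrite -expgM E4.
by rewrite (orderXpfactor (k := 1) ox2).
Qed.

Lemma center_cycle x u : x \in G -> x \notin 'Z(G) -> u \in 'Z(G) ->
  u \in <[x]> -> u != 1 -> u = x ^+ 2.
Proof.
move=> Gx nZx Zu xu ntu.
by apply: (socle_two (i := 0) (m := 1) (G := G) pr2 _ Gx); rewrite ?noncentral_order ?center_sqr.
Qed.

Lemma sqr_ex u : u \in 'Z(G) -> exists2 w, w \in G & w ^+ 2 = u.
Proof.
move=> Zu; apply: (exp_p_root pr2 pG regG ZE1 ncG); last exact: center_sqr.
exact: subsetP (center_sub G) _ Zu.
Qed.

(** A nontrivial [x, y] lies in <x> and in <y>, so it equals both x ^ 2 and y ^ 2. This leaves a
    single involution and order at most 8, and a 2-group with one involution is cyclic or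
    generalized quaternion. *)
Lemma cycle_commg_quaternion :
  {in G &, forall x y, [~ x, y] \in <[x]>} -> G \isog 'Q_8.
Proof.
move=> cyc; have sZG := subsetP (center_sub G).
have nc_eq x y : x \in G -> y \in G -> [~ x, y] != 1 -> [~ x, y] = x ^+ 2.
  move=> Gx Gy nt; apply: center_cycle; rewrite ?commg_center ?cyc //.
  by apply: contra nt => Zx; rewrite (center_commg Zx).
have [x Gx [y Gy ntxy]] : exists2 x, x \in G & exists2 y, y \in G & [~ x, y] != 1.
  have [/exists_inP[x Gx /exists_inP[y Gy nt]] | no] :=
    boolP [exists x in G, exists y in G, [~ x, y] != 1].
    by exists x => //; exists y.
  case/negP: ncG; apply/centsP => x Gx y Gy.
  move: no; rewrite negb_exists_in => /forall_inP/(_ x Gx).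
  by rewrite negb_exists_in => /forall_inP/(_ y Gy)/negPn/commgP.
pose a := [~ x, y].
have Za : a \in 'Z(G) by rewrite commg_center.
have x2 : x ^+ 2 = a by rewrite -(nc_eq x y).
have y2 : y ^+ 2 = a by rewrite -(nc_eq y x) // class2_comm_sym.
(* A square root z of another involution b commutes with all square roots of a; then (z * x) ^ 2 is
   b * a by expansion, but a because it equals [z * x, y]. *)
have Zxy2 b : b \in 'Z(G) -> b != 1 -> b = a.
  move=> Zb ntb; apply/eqP; apply: contraT => nab.
  have [z Gz z2] := sqr_ex Zb.
  have cz g : g \in G -> g ^+ 2 = a -> [~ z, g] = 1.
    move=> Gg g2; apply/eqP; apply: contraT => nt; case/eqP: nab.
    by rewrite -z2 -(nc_eq z g) // (class2_comm_sym Gg Gz) nc_eq ?g2 // -(class2_comm_sym Gg Gz).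
  have zxy : [~ z * x, y] = a by rewrite class2_commMl // cz // mul1g.
  have : (z * x) ^+ 2 = a by rewrite -(nc_eq (z * x) y) ?groupM ?zxy.
  rewrite class2_sqrM // cz // mulg1 z2 x2 => /eqP.
  by rewrite -{2}[a]mul1g (inj_eq (mulIg _)) (negPf ntb).
have cxyZ g : g \in G -> [~ g, x] = 1 -> [~ g, y] = 1 -> g \in 'Z(G).
  move=> Gg gx gy; apply: contraT => nZg.
  have g2 : g ^+ 2 = a by apply: Zxy2; [apply: sqr_center | rewrite -ZE].
  have Zgx : g * x \in 'Z(G).
    by rewrite ZE ?groupM // class2_sqrM // gx g2 x2 mulg1 center_mulK.
  case/eqP: ntxy; rewrite -[RHS](center_commg Zgx Gy) class2_commMl //.
  by rewrite gy mul1g.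
pose f (t : bool * bool * bool) := a ^+ t.1.1 * (x ^+ t.1.2 * y ^+ t.2)^-1.
have sGf : G \subset [set f t | t : bool * bool * bool].
  (* The exponents are crossed: [h, x] sees only the factor y of h, and [h, y] only the factor x.
     Thus g * h commutes with x and y, hence is central. *)
  apply/subsetP=> g Gg; pose i := [~ g, y] != 1; pose j := [~ g, x] != 1.
  pose h := x ^+ i * y ^+ j; have Gh : h \in G by rewrite groupM ?groupX.
  have Zgh : g * h \in 'Z(G).
    have cg u : u \in G -> [~ g, u] = a ^+ ([~ g, u] != 1).
      move=> Gu; case: eqVneq => [-> // | nt]; rewrite expg1.
      by apply: Zxy2; rewrite ?commg_center.
    have hx : [~ h, x] = a ^+ j.
      rewrite class2_commMl ?groupX // (commute_commg (commute_sym (commuteX i (erefl (x * x))))).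
      by rewrite mul1g; case: (j); rewrite ?expg0 ?comm1g // !expg1 class2_comm_sym.
    have hy : [~ h, y] = a ^+ i.
      rewrite class2_commMl ?groupX // (commute_commg (commute_sym (commuteX j (erefl (y * y))))).
      by rewrite mulg1; case: (i); rewrite ?expg0 ?comm1g // !expg1.
    apply: cxyZ; first exact: groupM.
      by rewrite class2_commMl // hx cg // center_mulK ?groupX.
    by rewrite class2_commMl // hy cg // center_mulK ?groupX.
  have [k gh] : exists k : bool, g * h = a ^+ k.
    have [-> | nt] := eqVneq (g * h) 1; first by exists false.
    by exists true; rewrite expg1; apply: Zxy2.
  by apply/imsetP; exists (k, i, j) => //; rewrite /f /= -gh mulgK.
have leG8 : #|G| <= 8.
  rewrite (leq_trans (subset_leq_card sGf)) // (leq_trans (leq_imset_card _ _)) //.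
  by rewrite !card_prod card_bool.
have oa : #[a] = 2 by apply: exp_p_order; rewrite ?center_sqr.
have Ohm_a : 'Ohm_1(G) = <[a]>.
  rewrite (OhmE 1 pG) -(genGid <[a]>) /= (cycle2g oa); congr <<_>>; apply/setP=> z.
  rewrite !inE expn1; apply/andP/orP=> [[Gz z2] | ].
    have Zz : z \in 'Z(G) by rewrite ZE.
    have [-> | nt] := eqVneq z 1; first by left.
    by right; apply/eqP; apply: Zxy2.
  case=> /eqP->; first by rewrite group1 expg1n.
  by rewrite sZG // center_sqr.
have ntG : G :!=: 1 by apply: contra ncG => /eqP->; apply: abelian1.
have /orP[cG | /andP[_ /eqP/quaternion_classP[n n_gt2 isoG]]] :
    cyclic G || (2 == 2) && (extremal_class G == Quaternion).
- by apply/(prime_Ohm1P pG ntG); rewrite Ohm_a.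
- by have:= ncG; rewrite (cyclic_abelian cG).
have le_n3 : n <= 3.
  rewrite -(leq_exp2l (m := 2)) // -(card_quaternion n_gt2).
  by rewrite -(card_isog isoG).
have n3 : n = 3 by apply/eqP; rewrite eqn_leq le_n3.
by rewrite n3 in isoG.
Qed.

(** * Commutator maps onto the center *)

Section Surjective.

Hypothesis big_commg : exists2 x, x \in G & exists2 y, y \in G & [~ x, y] \notin <[x]>.

Let N := #|'Z(G)|.

Lemma card_center_gt2 : 2 < N.
Proof.
have [x Gx [y Gy nxv]] := big_commg; set v := [~ x, y] in nxv.
have ntv : v != 1 by apply: contra nxv => /eqP->; rewrite group1.
have nZx : x \notin 'Z(G) by apply: contra ntv => Zx; apply/eqP/(center_commg Zx Gy).
have sub : [set 1; x ^+ 2; v] \subset 'Z(G).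
  by apply/subsetP=> z; rewrite 2!in_setU !in_set1 => /orP[/orP[]|] /eqP->;
    [apply: group1 | apply: sqr_center | apply: commg_center].
apply: leq_trans (subset_leq_card sub).
rewrite setUC cardsU1 cards2 !inE (negPf ntv) [1 == _]eq_sym -ZE // nZx /=.
by rewrite (_ : v == _ = false) //; apply: contraNF nxv => /eqP->; apply: mem_cycle.
Qed.

Lemma exists_center_notin x : x \in G -> x \notin 'Z(G) -> exists2 v, v \in 'Z(G) & v \notin <[x]>.
Proof.
move=> Gx nZx; apply/subsetPn; apply: contraL card_center_gt2 => sZx.
rewrite -leqNgt; apply: (@leq_trans #|[set 1; x ^+ 2]|); last by rewrite cards2; case: (_ != _).
apply: subset_leq_card; apply/subsetP=> u Zu; rewrite !inE.
by case: eqVneq => //= ntu; apply/eqP/center_cycle => //; apply: (subsetP sZx).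
Qed.

(** All pairs (x, u) with x noncentral and u central outside <x> have the same type, so the one
    value given by [big_commg] transfers; a central value inside <x> is a product of two outside. *)
Lemma commg_surj x v : x \in G -> x \notin 'Z(G) -> v \in 'Z(G) ->
  exists2 y, y \in G & [~ x, y] = v.
Proof.
move=> Gx nZx Zv.
have out u : u \in 'Z(G) -> u \notin <[x]> -> exists2 y, y \in G & [~ x, y] = u.
  move=> Zu nxu; have [x0 Gx0 [y0 Gy0 nx0v]] := big_commg.
  have nZx0 : x0 \notin 'Z(G).
    by apply: contra nx0v => Zx0; rewrite (center_commg Zx0 Gy0) group1.
  have Zv0 := commg_center Gx0 Gy0; set v0 := [~ x0, y0] in nx0v Zv0.
  have nt (w z : gT) : z \notin <[w]> -> z != 1 by apply: contra => /eqP->; rewrite group1.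
  have iso : assign_iso [:: x0; v0] [:: x; u].
    apply: assign_iso_dprod.
    - exact/commute_sym/(center_commute Zv0).
    - exact/commute_sym/(center_commute Zu).
    - exact: exp_p_TI pr2 _ _ (center_sqr Zv0) nx0v.
    - exact: exp_p_TI pr2 _ _ (center_sqr Zu) nxu.
    - by rewrite !noncentral_order.
    - by rewrite (exp_p_order pr2 (center_sqr Zv0) (nt _ _ nx0v)) (exp_p_order pr2 (center_sqr Zu) (nt _ _ nxu)).
  have sZG := subsetP (center_sub G).
  have [|y Gy] := reg_ex (ls := [:: (true, (Comm (Var 0) (Var 2), Var 1))]) regG
    Gx0 (sZG _ Zv0) Gx (sZG _ Zu) iso Gy0; first by rewrite /sat /= eqxx.
  by rewrite /sat /= andbT => /eqP/eqP; exists y.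
have [xv | nxv] := boolP (v \in <[x]>); last exact: out.
have [v1 Zv1 nxv1] := exists_center_notin Gx nZx.
have [y1 Gy1 xy1] := out v1 Zv1 nxv1.
have [||y2 Gy2 xy2] := out (v * v1); first exact: groupM.
  by apply: contra nxv1; rewrite groupMl.
exists (y2 * y1); first exact: groupM.
by rewrite class2_commMr // xy1 xy2 -mulgA center_mulK ?mulg1.
Qed.

(** The index of the center, which is also the size of each fiber of [x, -] for noncentral x. *)
Let c := #|G| %/ N.

Let cardG : #|G| = (N * c)%N.
Proof. by rewrite mulnC divnK // cardSg ?center_sub. Qed.

Let N_gt0 : 0 < N := cardG_gt0 _.

Lemma card_commg_fiber x v : x \in G -> x \notin 'Z(G) -> v \in 'Z(G) ->
  #|[set y in G | [~ x, y] == v]| = c.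
Proof.
move=> Gx nZx.
have fib u : u \in 'Z(G) -> #|[set y in G | [~ x, y] == u]| = #|[set y in G | [~ x, y] == 1]|.
  move=> Zu; have [y0 Gy0 xy0] := commg_surj Gx nZx Zu.
  rewrite -(card_lcoset [set y in G | [~ x, y] == 1] y0); apply: eq_card => y.
  rewrite mem_lcoset !inE; apply/andP/andP=> [[Gy /eqP xy]|[Gy /eqP xy]].
    rewrite groupM ?groupV // class2_commMr ?groupV // xy.
    by rewrite -xy0 -class2_commMr ?groupV // mulVg commg1.
  rewrite -{2}[y](mulKVg y0); have Gy' : y \in G by rewrite -(mulKVg y0 y) groupM.
  by rewrite (class2_commMr Gx Gy0 Gy) xy mulg1 xy0.
move=> Zv; rewrite fib //; have := cardG.
rewrite (@card_fibers _ _ _ 'Z(G) (commg x)); last by move=> y Gy; apply: commg_center.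
rewrite (eq_bigr (fun => #|[set y in G | [~ x, y] == 1]|)) // sum_nat_const -/N => /eqP.
by rewrite eqn_pmul2l // => /eqP.
Qed.

Let R a := #|[set x in G | x ^+ 2 == a]|.

Lemma card_roots_eq a b : a \in 'Z(G) -> b \in 'Z(G) -> a != 1 -> b != 1 -> R a = R b.
Proof.
move=> Za Zb nta ntb; have sZG := subsetP (center_sub G).
have oab : #[a] = #[b] by rewrite !(exp_p_order pr2) ?center_sqr.
have := reg_card regG [:: (true, (Exp (Var 2) 2, Var 0))]
  (sZG _ Za) (group1 G) (sZG _ Zb) (group1 G) (assign_iso_order oab).
rewrite /R => eq_ab; move: (eq_ab); congr (_ = _); apply: eq_card => x;
  by rewrite !inE /sat /= andbT eqb_id.
Qed.

Lemma roots1 : R 1 = N.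
Proof.
apply: eq_card => x; rewrite inE; apply/andP/idP=> [[Gx]|Zx]; first by rewrite -ZE.
by rewrite -ZE ?(subsetP (center_sub G)).
Qed.

(** Counting pairs (x, h) with (x * h) ^ 2 = x ^ 2 by x and by h gives R a = N + c. Sorting G by
    squares gives N * c = N + (N - 1) * R a, whence c = N ^ 2. *)
Lemma card_roots_center a : a \in 'Z(G) -> a != 1 ->
  c = (N ^ 2)%N /\ R a = (N + N ^ 2)%N.
Proof.
move=> Za nta.
have G_roots : #|G| = (N + (N - 1) * R a)%N.
  rewrite (@card_fibers _ _ _ 'Z(G) (fun x => x ^+ 2)); last exact: sqr_center.
  rewrite (bigD1 1) ?group1 //= -/(R 1) roots1; congr (_ + _)%N.
  rewrite (eq_bigr (fun => R a)) => [|b /andP[Zb ntb]]; last exact: card_roots_eq.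
  rewrite sum_nat_const; congr (_ * _)%N.
  by rewrite /N (cardsD1 1 'Z(G)) group1 addKn; apply: eq_card => b; rewrite in_setD1 andbC.
have sumZ (F : gT -> nat) k l : {in 'Z(G), forall x, F x = k} ->
    {in G, forall x, x \notin 'Z(G) -> F x = l} ->
    \sum_(x in G) F x = (N * k + (#|G| - N) * l)%N.
  move=> Fk Fl; rewrite (bigID (mem 'Z(G))) /=; congr (_ + _)%N.
    rewrite (eq_bigl (mem 'Z(G))) => [|x]; last first.
      by apply/andP/idP=> [[]//|Zx]; rewrite (subsetP (center_sub G)).
    by rewrite (eq_bigr (fun => k)) // sum_nat_const.
  rewrite (eq_bigr (fun => l)) => [|x /andP[Gx nZx]]; last exact: Fl.
  rewrite sum_nat_const -cardsDS ?center_sub //; congr (_ * _)%N.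
  by apply: eq_card => x; rewrite in_setD andbC.
have count1 : \sum_(x in G) #|[set h in G | (x * h) ^+ 2 == x ^+ 2]| =
    (N * N + (#|G| - N) * R a)%N.
  have shift x : x \in G -> #|[set h in G | (x * h) ^+ 2 == x ^+ 2]| = R (x ^+ 2).
    move=> Gx; rewrite /R -(card_lcoset [set h in G | _] x); apply: eq_card => y.
    by rewrite mem_lcoset !inE mulKVg groupMl ?groupV.
  apply: sumZ => [x Zx | x Gx nZx].
    by rewrite shift ?(subsetP (center_sub G)) // center_sqr // roots1.
  by rewrite shift //; apply: card_roots_eq; rewrite ?sqr_center // -ZE.
have count2 : \sum_(x in G) #|[set h in G | (x * h) ^+ 2 == x ^+ 2]| =
    (N * #|G| + (#|G| - N) * c)%N.
  under eq_bigr do rewrite card_sum_nat.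
  rewrite exchange_big /=; under eq_bigr do rewrite -card_sum_nat.
  (* For fixed h the solutions x form the fiber of [h, -] over h ^ 2. *)
  have sqrE : {in G &, forall x h, ((x * h) ^+ 2 == x ^+ 2) = ([~ h, x] == h ^+ 2)}.
    move=> x h Gx Gh; rewrite class2_sqrM // -mulgA -{2}[x ^+ 2]mulg1 (inj_eq (mulgI _)).
    by rewrite -eq_invg_mul center_inv ?sqr_center // (class2_comm_sym Gx Gh) eq_sym.
  apply: sumZ => [h Zh | h Gh nZh].
    have Gh := subsetP (center_sub G) _ Zh.
    apply: eq_card => x; rewrite inE; case Gx: (x \in G) => //=.
    by rewrite sqrE // (center_commg Zh Gx) center_sqr ?eqxx.
  rewrite -(card_commg_fiber Gh nZh (sqr_center Gh)); apply: eq_card => x.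
  by rewrite !inE; case Gx: (x \in G) => //=; rewrite sqrE.
have N_gt2 := card_center_gt2.
move: count1 G_roots; rewrite count2 cardG.
(* Writing N = n + 3 and c = d + 2 removes truncated subtraction and shows the cancelled factor N *
   (c - 1) to be positive. *)
have [n defN] : exists n, N = n.+3 by exists (N - 3); lia.
have c_gt1 : 1 < c.
  rewrite ltnNge; apply: contra ncG => le_c1.
  suff -> : G :=: 'Z(G) by apply: center_abelian.
  apply/eqP; rewrite eq_sym eqEcard center_sub cardG.
  by rewrite -/N -{2}[N]muln1 leq_mul2l le_c1 orbT.
have [d defc] : exists d, c = d.+2 by exists (c - 2); lia.
rewrite defN defc; set r := R a; move=> eq1 eq2.
have r_eq : r = (n.+3 + d.+2)%N.
  apply/eqP; rewrite -(@eqn_pmul2l (n.+3 * d.+1)) //; apply/eqP.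
  by move: eq1; rewrite [(_ - _)%N](_ : _ = n.+3 * d.+1)%N; lia.
suff -> : d.+2 = (n.+3 ^ 2)%N by split=> //; rewrite r_eq; lia.
by move: eq2; rewrite r_eq; lia.
Qed.

(** * Square roots of a fixed central involution *)

Section Roots.

Variable a : gT.
Hypotheses (Za : a \in 'Z(G)) (nta : a != 1).

Let S := [set x in G | x ^+ 2 == a].

Lemma root_noncentral x : x \in G -> x ^+ 2 = a -> x \notin 'Z(G).
Proof. by move=> Gx x2; rewrite ZE // x2. Qed.

Lemma commuting_roots x z : x \in G -> z \in G -> x ^+ 2 = a -> z ^+ 2 = a ->
  [~ x, z] = 1 -> z \in x *: 'Z(G).
Proof.
move=> Gx Gz x2 z2 xz; rewrite mem_lcoset ZE ?groupM ?groupV //.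
have xV : [~ x^-1, z] = 1 by apply/commute_commg/commute_sym/commuteV/commute_sym/commgP; rewrite xz.
by rewrite class2_sqrM ?groupV // expgVn x2 z2 xV mulg1 mulVg.
Qed.

Lemma coset_center_root x z : x \in G -> x ^+ 2 = a -> z \in x *: 'Z(G) ->
  [/\ z \in G, z ^+ 2 = a & [~ x, z] = 1].
Proof.
move=> Gx x2 /lcosetP[k Zk ->]; have Gk := subsetP (center_sub G) _ Zk.
have xk : [~ x, k] = 1 by apply/commute_commg/commute_sym/(center_commute Zk).
by rewrite groupM // class2_sqrM // class2_commMr // commgg xk (center_sqr Zk) x2 !mulg1.
Qed.

Let T x w := #|[set z in G | (z ^+ 2 == a) && ([~ x, z] == w)]|.
Let t x w := #|[set A in G / 'Z(G) | (repr A ^+ 2 == a) && ([~ x, repr A] == w)]|.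

Let TE x w : x \in G -> T x w = (N * t x w)%N.
Proof.
move=> Gx; apply: (card_quotient_pred (P := fun z => (z ^+ 2 == a) && ([~ x, z] == w)));
  first exact: center_normal.
move=> z k Gz Zk; have Gk := subsetP (center_sub G) _ Zk.
have ck y : y \in G -> [~ y, k] = 1.
  by move=> Gy; apply/commute_commg/commute_sym/(center_commute Zk).
by rewrite /= class2_sqrM // class2_commMr // !ck // (center_sqr Zk) !mulg1.
Qed.

(** The center meets <x> only in 1 and a, so <x> and <w> form a direct product of the same type for
    all these choices. *)
Let T_const x x' w w' : x \in G -> x' \in G -> x ^+ 2 = a -> x' ^+ 2 = a ->
  w \in 'Z(G) -> w' \in 'Z(G) -> w != 1 -> w' != 1 -> w != a -> w' != a -> T x w = T x' w'.
Proof.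
move=> Gx Gx' x2 x2' Zw Zw' ntw ntw' nwa nwa'; have sZG := subsetP (center_sub G).
have out y u : y \in G -> y ^+ 2 = a -> u \in 'Z(G) -> u != 1 -> u != a -> u \notin <[y]>.
  move=> Gy y2 Zu ntu; apply: contra => yu.
  by rewrite (center_cycle Gy (root_noncentral Gy y2) Zu yu ntu) y2.
have iso : assign_iso [:: x; w] [:: x'; w'].
  apply: assign_iso_dprod.
  - exact/commute_sym/(center_commute Zw).
  - exact/commute_sym/(center_commute Zw').
  - exact: exp_p_TI pr2 _ _ (center_sqr Zw) (out _ _ Gx x2 Zw ntw nwa).
  - exact: exp_p_TI pr2 _ _ (center_sqr Zw') (out _ _ Gx' x2' Zw' ntw' nwa').
  - by rewrite (noncentral_order Gx (root_noncentral Gx x2))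
               (noncentral_order Gx' (root_noncentral Gx' x2')).
  - by rewrite (exp_p_order pr2 (center_sqr Zw) ntw) (exp_p_order pr2 (center_sqr Zw') ntw').
have := reg_card regG [:: (true, (Exp (Var 2) 2, Exp (Var 0) 2));
    (true, (Comm (Var 0) (Var 2), Var 1))] Gx (sZG _ Zw) Gx' (sZG _ Zw') iso.
rewrite /T => eq_T; move: (eq_T); congr (_ = _); apply: eq_card => z;
  by rewrite !inE /sat /= andbT !eqb_id ?x2 ?x2'.
Qed.

(* T x w is N times the number t of cosets of roots z of a with [x, z] = w, which is
   the same for all x and all w other than 1, a.  The relation [x, z] = w is a
   t-regular graph on the N + 1 cosets of roots, so t is even, while
   (N - 2) * t <= N.  If t = 0, any two roots in distinct cosets have commutator a,
   which fails for y against x, z and x z. *)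
Lemma card_center_roots : N = 4.
Proof.
have N_gt2 := card_center_gt2; have sZG := subsetP (center_sub G).
have [_ cardS] := card_roots_center Za nta; have {}cardS : #|S| = (N + N ^ 2)%N := cardS.
have SP x : reflect (x \in G /\ x ^+ 2 = a) (x \in S).
  by rewrite inE; apply: (iffP andP) => -[Gx /eqP].
have cardZ : N = (2 + #|('Z(G) :\ 1%g) :\ a|)%N.
  by rewrite /N (cardsD1 1 'Z(G)) group1 (cardsD1 a ('Z(G) :\ 1)) in_setD1 nta Za.
have {}cardZ : #|('Z(G) :\ 1%g) :\ a| = (N - 2)%N by rewrite cardZ addKn.
have Na : 0 < #|('Z(G) :\ 1) :\ a| by rewrite cardZ subn_gt0.
have [w0] := card_gt0P Na; rewrite !in_setD1 => /and3P[nw0a ntw0 Zw0].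
have [x0 Sx0] : exists x0, x0 \in S by apply/card_gt0P; rewrite cardS addn_gt0 N_gt0.
have /SP[Gx0 x02] := Sx0.
pose t0 := t x0 w0.
have tE x w : x \in S -> w \in ('Z(G) :\ 1) :\ a -> t x w = t0.
  move=> /SP[Gx x2]; rewrite !in_setD1 => /and3P[nwa ntw Zw].
  apply/eqP; rewrite -(eqn_pmul2l N_gt0) -(TE w Gx) -(TE w0 Gx0); apply/eqP; exact: T_const.
(* The roots are sorted by commutator with x: N of them commute with x, then comes the value a, then
   N - 2 values with equal counts. *)
have sum_t x : x \in S -> (N + N ^ 2 = N + (T x a + (N - 2) * (N * t0)))%N.
  move=> Sx; have /SP[Gx x2] := Sx; rewrite -cardS.
  rewrite (@card_fibers _ _ _ 'Z(G) (commg x)); last by move=> z /SP[Gz _]; apply: commg_center.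
  rewrite (big_setD1 1) ?group1 //= (big_setD1 a) ?in_setD1 ?nta //=.
  congr (_ + (_ + _))%N.
  - rewrite /N -(card_lcoset 'Z(G) x); apply: eq_card => z; rewrite in_set.
    apply/andP/idP=> [[/SP[Gz z2] /eqP xz] | zx]; first exact: commuting_roots.
    by have [Gz z2 ->] := coset_center_root Gx x2 zx; split=> //; apply/SP.
  - by apply: eq_card => z; rewrite !inE andbA.
  rewrite (eq_bigr (fun => (N * t0)%N)) ?sum_nat_const ?cardZ // => w Ww.
  rewrite -(tE x w) // -(TE w Gx); by apply: eq_card => z; rewrite !inE andbA.
have t0_even : 2 %| t0.
  pose A := [set B in G / 'Z(G) | repr B ^+ 2 == a].
  have cardA : #|A| = (1 + N)%N.
    apply/eqP; rewrite -(eqn_pmul2l N_gt0); apply/eqP.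
    rewrite -(card_quotient_pred (P := fun z => z ^+ 2 == a) (center_normal G)).
      by rewrite -/S cardS mulnDr muln1.
    move=> z k Gz Zk; have Gk := sZG _ Zk.
    have zk : [~ z, k] = 1 by apply/commute_commg/commute_sym/(center_commute Zk).
    by rewrite /= class2_sqrM // zk (center_sqr Zk) !mulg1.
  pose e (B C : coset_of 'Z(G)) := [~ repr B, repr C] == w0.
  have e_sym : symmetric e.
    by move=> B C; rewrite /e -invg_comm -{1}(center_inv Zw0) (inj_eq invg_inj).
  have e_irr : irreflexive e by move=> B; rewrite /e commgg eq_sym (negPf ntw0).
  have := handshake A e_sym e_irr.
  rewrite (eq_bigr (fun => t0)) => [|B]; last first.
    rewrite inE => /andP[QB /eqP B2]; rewrite -(tE (repr B) w0).
    - by apply: eq_card => C; rewrite !inE andbA.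
    - by apply/SP; split=> //; apply: repr_quotient_mem QB; apply: center_normal.
    - by rewrite !in_setD1 nw0a ntw0.
  rewrite sum_nat_const cardA Gauss_dvdr // coprime2n oddD /=.
  have /p_natP[k oZ] : 2.-nat N := pgroupS (center_sub G) pG.
  by rewrite oZ in N_gt2 *; case: k N_gt2 {oZ} => // k _; rewrite expnS mul2n odd_double.
have /p_natP[k oZ] : 2.-nat N := pgroupS (center_sub G) pG.
suff leN4 : N <= 4.
  move: N_gt2 leN4; rewrite oZ; case: k {oZ} => [|[|[|k]]] // _.
  by rewrite (@leq_exp2l 2 _ 2).
have [t00 | t0_gt0] := posnP t0; last first.
  have := sum_t x0 Sx0; case/dvdnP: t0_even t0_gt0 => s -> s_gt0 /addnI.
  rewrite leqNgt => eqN; apply/negP=> N_gt4; move: eqN; apply/eqP.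
  rewrite neq_ltn ltn_addl // mulnCA -mulnn ltn_pmul2l //.
  apply: leq_trans (ltn_double_sub2 N_gt4) _; rewrite leq_mul2l leq_pmull ?orbT //.
  by case: (s) s_gt0.
have T0 x w : x \in S -> w \in ('Z(G) :\ 1) :\ a -> T x w = 0.
  by move=> Sx Ww; have /SP[Gx _] := Sx; rewrite TE // tE // t00 muln0.
have comm_a x z : x \in S -> z \in S -> z \notin x *: 'Z(G) -> [~ x, z] = a.
  move=> Sx Sz nxz; have [/SP[Gx x2] /SP[Gz z2]] := (Sx, Sz).
  apply/eqP; apply: contraT => nca.
  have Wxz : [~ x, z] \in ('Z(G) :\ 1) :\ a.
    rewrite !in_setD1 nca commg_center // andbT /=.
    by apply: contra nxz => /eqP; apply: commuting_roots.
  have: z \in [set y in G | (y ^+ 2 == a) && ([~ x, y] == [~ x, z])].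
    by rewrite inE Gz z2 !eqxx.
  by rewrite (cards0_eq (T0 x _ Sx Wxz)) inE.
have cardC x : #|x *: 'Z(G)| = N by rewrite card_lcoset.
have [z Sz nxz] : exists2 z, z \in S & z \notin x0 *: 'Z(G).
  apply/subsetPn; apply/negP=> /subset_leq_card; rewrite cardS cardC leqNgt.
  by rewrite -{1}[N]addn0 ltn_add2l expn_gt0 N_gt0.
have [Gz z2] := SP _ Sz.
have Sxz : x0 * z \in S.
  by apply/SP; rewrite groupM // class2_sqrM // comm_a // x02 z2 center_mulK // mul1g.
(* Three cosets cover at most 3 * N of the N + N ^ 2 roots, and N > 2. *)
have [y Sy] : exists2 y, y \in S & y \notin x0 *: 'Z(G) :|: z *: 'Z(G) :|: (x0 * z) *: 'Z(G).
  apply/subsetPn; apply/negP=> /subset_leq_card; rewrite cardS leqNgt => /negP[].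
  apply: leq_ltn_trans (leq_card_setU _ _) _.
  apply: leq_ltn_trans (leq_add (leq_card_setU _ _) (leqnn _)) _.
  rewrite !cardC -addnA ltn_add2l addnn -mul2n -mulnn ltn_pmul2r //.
rewrite !in_setU !negb_or => /andP[/andP[nyx nyz] nyxz].
have [Gy y2] := SP _ Sy; case/eqP: nta.
rewrite -(comm_a _ _ Sxz Sy nyxz) class2_commMl // comm_a // comm_a //.
by rewrite center_mulK.
Qed.

End Roots.

Lemma card_center_eq4 : N = 4.
Proof.
have [a] : exists a, a \in 'Z(G) :\ 1.
  apply/card_gt0P; have := card_center_gt2; rewrite /N (cardsD1 1 'Z(G)) group1.
  by case: #|_|.
by rewrite in_setD1 => /andP[nta Za]; apply: card_center_roots Za nta.
Qed.

Let cardc : c = 16.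
Proof.
have [x Gx [y Gy nxv]] := big_commg; have nZx : x \notin 'Z(G).
  by apply: contra nxv => Zx; rewrite (center_commg Zx Gy) group1.
have [|-> _] := card_roots_center (sqr_center Gx); first by rewrite -ZE.
by rewrite card_center_eq4.
Qed.

Lemma card_group64 : #|G| = 64.
Proof. by rewrite cardG cardc card_center_eq4. Qed.

(** The centralizer of g has order 16, and its center contains g besides the 4 elements of the
    center of G. The quotient by that center has order at most 2, so the centralizer is abelian. *)
Lemma commg_trans g h h' : g \in G -> g \notin 'Z(G) -> h \in G -> h' \in G ->
  [~ g, h] = 1 -> [~ g, h'] = 1 -> [~ h, h'] = 1.
Proof.
move=> Gg nZg Gh Gh' gh gh'; pose C := 'C_G[g]%G.
have CP y : (y \in C) = (y \in G) && ([~ g, y] == 1).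
  by rewrite in_setI; congr (_ && _); apply/cent1P/commgP.
have cardC : #|C| = 16.
  rewrite -cardc -(card_commg_fiber Gg nZg (group1 _)); apply: eq_card => y.
  by rewrite CP inE.
have sZC : 'Z(G) \subset 'Z(C).
  apply/subsetP=> z Zz; have Gz := subsetP (center_sub G) _ Zz.
  have cz y : y \in G -> commute z y by apply: center_commute.
  apply/centerP; split; last by move=> y; rewrite CP => /andP[Gy _]; apply: cz.
  by rewrite CP Gz; apply/commgP/commute_sym/cz.
have Zg : g \in 'Z(C).
  apply/centerP; split; first by rewrite CP Gg commgg eqxx.
  by move=> y; rewrite CP => /andP[_ /commgP].
have gt4 : 4 < #|'Z(C)|.
  rewrite -card_center_eq4; apply: proper_card; rewrite properE sZC.
  by apply/subsetPn; exists g.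
have dvZ : #|'Z(C)| %| 16 by rewrite -cardC cardSg ?center_sub.
have cQ : cyclic (C / 'Z(C)).
  have : #|C / 'Z(C)| <= 2.
    rewrite card_quotient ?normal_norm ?center_normal // -divgS ?center_sub // cardC.
    have : #|'Z(C)| \in divisors 16 by rewrite -dvdn_divisors.
    by move: gt4; rewrite !inE => gt4 /or4P[|||/orP[]] /eqP eqZ; rewrite eqZ // in gt4 *.
  case: ltngtP => // [lt2 _ | eq2 _]; last by apply: prime_cyclic; rewrite eq2.
  have -> : C / 'Z(C) = 1; last exact: cyclic1.
  by apply/eqP; rewrite trivg_card1 eqn_leq -ltnS lt2 cardG_gt0.
have /centsP cC := cyclic_center_factor_abelian cQ.
by apply/commute_commg/cC; rewrite CP ?Gh ?Gh' ?gh ?gh' eqxx.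
Qed.

(** * Coordinates on the center of order four *)

Section KleinCenter.

Variables a b : gT.
Hypotheses (Za : a \in 'Z(G)) (Zb : b \in 'Z(G)) (nta : a != 1) (ntb : b != 1) (nab : a != b).

Let vz (i j : bool) := a ^+ i * b ^+ j.

Lemma kleinM i j k l : vz i j * vz k l = vz (i (+) k) (j (+) l).
Proof.
have aa := center_mulK Za; have bb := center_mulK Zb.
have ab : commute b a by apply: (center_commute Zb); apply: (subsetP (center_sub G)).
rewrite /vz -!mulgA (mulgA (b ^+ j)) (commuteX2 _ _ ab) -!mulgA.
have addX (u : gT) (m n : bool) : u * u = 1 -> u ^+ m * u ^+ n = u ^+ (m (+) n).
  by move=> uu; case: m n => [] []; rewrite ?expg1 ?expg0 ?mulg1 ?mul1g.
by rewrite addX // mulgA addX.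
Qed.

Lemma klein_eq1 i j : (vz i j == 1) = ~~ (i || j).
Proof.
have aV := center_inv Za.
rewrite /vz; case: i j => [] []; rewrite ?expg1 ?expg0 ?mulg1 ?mul1g ?eqxx ?(negPf nta) ?(negPf ntb) //.
by rewrite -eq_invg_mul aV (negPf nab).
Qed.

Lemma klein_eq i j k l : (vz i j == vz k l) = (i == k) && (j == l).
Proof.
have -> : (vz i j == vz k l) = (vz i j * vz k l == 1).
  by rewrite -eq_invg_mul center_inv // /vz groupM ?groupX.
by rewrite kleinM klein_eq1; case: i; case: j; case: k; case: l.
Qed.

Lemma klein_center z : z \in 'Z(G) -> exists i, exists j, z = vz i j.
Proof.
move=> Zz; pose f (t : bool * bool) := vz t.1 t.2.
have sfZ : [set f t | t : bool * bool] \subset 'Z(G).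
  by apply/subsetP=> _ /imsetP[t _ ->]; rewrite /f /vz groupM ?groupX.
have f_inj : injective f.
  by move=> [i j] [k l] /eqP; rewrite klein_eq => /andP[/eqP/= -> /eqP/= ->].
have fZ : [set f t | t : bool * bool] = 'Z(G).
  apply/eqP; rewrite eqEcard sfZ card_imset // card_prod card_bool.
  by rewrite -[#|_|]/N card_center_eq4.
by move: Zz; rewrite -fZ => /imsetP[[i j] _ ->]; exists i, j.
Qed.

End KleinCenter.

(** The centralizer of x has 16 elements, so it contains y outside ['Z(G)] and x *: ['Z(G)]. Then y
    ^ 2 is b or a * b, and in the second case x * y is the root. *)
Lemma root_in_centralizer a b x : a \in 'Z(G) -> b \in 'Z(G) -> a != 1 -> b != 1 -> a != b ->
  x \in G -> x ^+ 2 = a ->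
  exists2 y, y \in G & y ^+ 2 = b /\ [~ x, y] = 1.
Proof.
move=> Za Zb nta ntb nab Gx x2; have nZx : x \notin 'Z(G) by rewrite ZE // x2.
have : ~~ ([set y in G | [~ x, y] == 1] \subset 'Z(G) :|: x *: 'Z(G)).
  apply/negP=> /subset_leq_card; rewrite card_commg_fiber // cardc leqNgt => /negP[].
  by apply: leq_ltn_trans (leq_card_setU _ _) _; rewrite card_lcoset -/N card_center_eq4.
case/subsetPn=> y; rewrite inE in_setU negb_or => /andP[Gy /eqP xy] /andP[nZy nxy].
have nty : y ^+ 2 != 1 by rewrite -ZE.
have nya : y ^+ 2 != a by apply: contra nxy => /eqP y2; apply: (commuting_roots Gx Gy x2 y2 xy).
have [i [j y2]] := klein_center Za Zb nta ntb nab (sqr_center Gy).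
move: nty nya; rewrite y2; case: i j y2 => [] [] y2; rewrite ?expg1 ?expg0 ?mulg1 ?mul1g ?eqxx //.
  exists (x * y); rewrite ?groupM //; split.
    by rewrite class2_sqrM // xy mulg1 y2 x2 !expg1 mulgA center_mulK ?mul1g.
  by rewrite class2_commMr // commgg xy mulg1.
by exists y => //; rewrite y2 expg1 expg0 mul1g.
Qed.

(** Modulo the generated subgroup, any g can be corrected to commute with e1 and e3; as these do not
    commute with each other, [commg_trans] makes the result central. *)
Lemma suzuki_gens_generate e1 e2 e3 e4 :
  e1 \in G -> e2 \in G -> e3 \in G -> e4 \in G -> suzuki_gens e1 e2 e3 e4 ->
  e1 ^+ 2 != 1 -> e2 ^+ 2 != 1 -> e1 ^+ 2 != e2 ^+ 2 ->
  <<[set x in [:: e1; e2; e3; e4]]>> = G.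
Proof.
move=> G1 G2 G3 G4 sg nt1 nt2 nt12; set H := <<_>>.
have [H1 H2 H3 H4] : [/\ e1 \in H, e2 \in H, e3 \in H & e4 \in H].
  by split; apply: mem_gen; rewrite !inE eqxx ?orbT.
apply/eqP; rewrite eqEsubset; apply/andP; split.
  rewrite gen_subG; apply/subsetP=> x; rewrite !inE.
  by case/or4P=> /eqP->.
have kc := klein_center (sqr_center G1) (sqr_center G2) nt1 nt2 nt12.
apply/subsetP=> g Gg.
have [s [t e1g]] := kc _ (commg_center G1 Gg).
have [u [v e3g]] := kc _ (commg_center G3 Gg).
(* The exponents t, s of e3, e4 reproduce [e1, g], and the exponents v, u of e1, e2 reproduce
   [e3, g]. *)
pose h := e1 ^+ v * e2 ^+ u * (e3 ^+ t * e4 ^+ s).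
have Hh : h \in H by rewrite !groupM ?groupX.
have Gh : h \in G by rewrite !groupM ?groupX.
have cX x y (i : bool) : x \in G -> y \in G -> [~ x, y ^+ i] = [~ x, y] ^+ i.
  by move=> Gx Gy; case: i; rewrite ?expg1 ?expg0 ?commg1.
have e1h : [~ e1, h] = [~ e1, g].
  rewrite /h !class2_commMr ?groupM ?groupX // !cX // e1g.
  rewrite commgg (suz_comm12 sg) (suz_comm13 sg) (suz_comm14 sg) !expg1n !mul1g.
  by apply/commuteX2/(center_commute (sqr_center G2)); rewrite groupX.
have e3h : [~ e3, h] = [~ e3, g].
  rewrite /h !class2_commMr ?groupM ?groupX // !cX // e3g.
  rewrite commgg (suz_comm34 sg) !expg1n !mulg1 !(class2_comm_sym _ G3) //.
  rewrite (suz_comm13 sg) (suz_comm23 sg).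
  by apply/commuteX2/(center_commute (sqr_center G2)); rewrite groupX.
have kill x : x \in G -> [~ x, h] = [~ x, g] -> [~ x, g * h] = 1.
  by move=> Gx xh; rewrite class2_commMr // xh center_mulK ?commg_center.
have Zgh : g * h \in 'Z(G).
  apply: contraT => nZ; case/eqP: nt2; rewrite -(suz_comm13 sg).
  have Ggh : g * h \in G by rewrite groupM.
  by apply: (commg_trans Ggh nZ G1 G3); rewrite class2_comm_sym // kill.
have [i [j gh]] := kc _ Zgh.
by rewrite -(mulgK h g) gh !groupM ?groupV ?groupX.
Qed.

(** Commuting roots x, y of a, b and another such pair x', y' are chosen with x, x' not commuting.
    The restrictions [ncom] and [nsqr] on commutators across the pairs are exactly the test
    [suzuki_table]. *)
Lemma exists_suzuki_gens : exists e1 e2 e3 e4,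
  [/\ [/\ e1 \in G, e2 \in G, e3 \in G & e4 \in G], suzuki_gens e1 e2 e3 e4,
      <<[set x in [:: e1; e2; e3; e4]]>> = G
    & forall z, z \in 'Z(G) -> exists i j : bool, z = (e1 ^+ 2) ^+ i * (e2 ^+ 2) ^+ j].
Proof.
have N4 := card_center_eq4; have sZG := subsetP (center_sub G).
have cardZ1 : #|'Z(G) :\ 1| = 3.
  by apply: (@addnI 1%N); have := N4; rewrite /N (cardsD1 1 'Z(G)) group1.
have [a] : exists a, a \in 'Z(G) :\ 1 by apply/card_gt0P; rewrite cardZ1.
rewrite in_setD1 => /andP[nta Za].
have [b] : exists b, b \in ('Z(G) :\ 1) :\ a.
  apply/card_gt0P; rewrite -(ltn_add2l 1); move: cardZ1.
  by rewrite (cardsD1 a) in_setD1 nta Za => ->.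
rewrite !in_setD1 => /and3P[nba ntb Zb].
have nab : a != b by rewrite eq_sym.
have [x Gx x2] := sqr_ex Za.
have [y Gy [y2 xy]] := root_in_centralizer Za Zb nta ntb nab Gx x2.
have [x' ] : exists x', x' \in [set z in G | z ^+ 2 == a] :\: x *: 'Z(G).
  (* There are 4 + 4 ^ 2 = 20 roots of a, and only 4 in the coset of x. *)
  apply/card_gt0P; rewrite cardsD subn_gt0.
  have [_ cardR] := card_roots_center Za nta; rewrite N4 in cardR.
  have -> : #|[set z in G | z ^+ 2 == a]| = 20 := cardR.
  by apply: leq_ltn_trans (subset_leq_card (subsetIr _ _)) _; rewrite card_lcoset -/N N4.
rewrite in_setD inE => /and3P[nxx' Gx' /eqP x2'].
have [y' Gy' [y2' xy']] := root_in_centralizer Za Zb nta ntb nab Gx' x2'.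
have nZ u w : w \in 'Z(G) -> w != 1 -> u \in G -> u ^+ 2 = w -> u \notin 'Z(G).
  by move=> Zw ntw Gu u2; rewrite ZE // u2.
have nZx := nZ _ _ Za nta Gx x2; have nZx' := nZ _ _ Za nta Gx' x2'.
have ncxx' : [~ x, x'] != 1.
  by apply: contra nxx' => /eqP; apply: (commuting_roots Gx Gx' x2 x2').
have ncom g h : g \in G -> h \in G -> g \notin 'Z(G) -> h \notin 'Z(G) ->
    [~ x, g] = 1 -> [~ x', h] = 1 -> [~ g, h] != 1.
  move=> Gg Gh nZg nZh xg x'h; apply: contra ncxx' => /eqP gh; apply/eqP.
  have gx : [~ g, x] = 1 by rewrite class2_comm_sym.
  have xh := commg_trans Gg nZg Gx Gh gx gh.
  by apply: (commg_trans Gh nZh Gx Gx'); rewrite class2_comm_sym.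
have nsqr g h : g \in G -> h \in G -> [~ g, h] != 1 -> [~ g, h] != g ^+ 2 * h ^+ 2.
  (* Equality would give (g * h) ^ 2 = 1, so g * h would be central and g would commute with h. *)
  move=> Gg Gh; apply: contra => /eqP eq_gh.
  have Zgh : g * h \in 'Z(G).
    by rewrite ZE ?groupM // class2_sqrM // eq_gh center_mulK // groupM ?sqr_center.
  by have:= center_commg Zgh Gh; rewrite class2_commMl // commgg mulg1 => ->.
have kc := klein_center Za Zb nta ntb nab.
have [r13 [s13 p13]] := kc _ (commg_center Gx Gx').
have [r14 [s14 p14]] := kc _ (commg_center Gx Gy').
have [r23 [s23 p23]] := kc _ (commg_center Gy Gx').
have [r24 [s24 p24]] := kc _ (commg_center Gy Gy').
have kM := kleinM Za Zb.
have sqrX u v (i j : bool) : u \in G -> v \in G -> u ^+ 2 = a -> v ^+ 2 = b -> [~ u, v] = 1 ->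
    (u ^+ i * v ^+ j) ^+ 2 = a ^+ i * b ^+ j.
  move=> Gu Gv u2 v2 /eqP/commgP uv; rewrite expgMn; last exact: commuteX2.
  by rewrite (expgAC u) u2 (expgAC v) v2.
have kX (r s i : bool) : (a ^+ r * b ^+ s) ^+ i = a ^+ (r && i) * b ^+ (s && i).
  by case: i; rewrite ?andbT ?andbF ?expg1 ?expg0 ?mulg1.
have table : suzuki_table r13 s13 r14 s14 r23 s23 r24 s24.
  apply/allP=> i _; apply/allP=> j _; apply/allP=> k _; apply/allP=> l _.
  apply/implyP=> /andP[ij kl].
  pose g := x ^+ i * y ^+ j; pose h := x' ^+ k * y' ^+ l.
  have Gg : g \in G by rewrite groupM ?groupX.
  have Gh : h \in G by rewrite groupM ?groupX.
  have g2 : g ^+ 2 = a ^+ i * b ^+ j by apply: sqrX.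
  have h2 : h ^+ 2 = a ^+ k * b ^+ l by apply: sqrX.
  have k1 := klein_eq1 Za nta ntb nab.
  have nZg : g \notin 'Z(G) by rewrite ZE // g2 k1 ij.
  have nZh : h \notin 'Z(G) by rewrite ZE // h2 k1 kl.
  have cXl (u v : gT) (m : bool) : [~ u ^+ m, v] = [~ u, v] ^+ m.
    by case: m; rewrite ?expg1 ?expg0 ?comm1g.
  have cXr (u v : gT) (m : bool) : [~ u, v ^+ m] = [~ u, v] ^+ m.
    by case: m; rewrite ?expg1 ?expg0 ?commg1.
  have xg : [~ x, g] = 1.
    by rewrite class2_commMr ?groupX // !cXr commgg xy !expg1n mulg1.
  have x'h : [~ x', h] = 1.
    by rewrite class2_commMr ?groupX // !cXr commgg xy' !expg1n mulg1.
  have nt := ncom g h Gg Gh nZg nZh xg x'h.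
  have := nsqr g h Gg Gh nt; move: nt; rewrite g2 h2.
  have -> : [~ g, h] = ([~ x, x'] ^+ k * [~ x, y'] ^+ l) ^+ i * ([~ y, x'] ^+ k * [~ y, y'] ^+ l) ^+ j.
    by rewrite class2_commMl ?groupX // !cXl !class2_commMr ?groupX // !cXr.
  rewrite p13 p14 p23 p24 !kX !kM !kX !kM k1 (klein_eq Za Zb nta ntb nab) negbK negb_and.
  by move=> A B; apply/andP.
have ab : commute a b by apply: (center_commute Za); apply: sZG.
have sa := center_sqr Za; have sb := center_sqr Zb.
have ca u : u \in G -> [~ a, u] = 1 by apply: center_commg.
have cb u : u \in G -> [~ b, u] = 1 by apply: center_commg.
have conclude e1 e2 e3 e4 : e1 \in G -> e2 \in G -> e3 \in G -> e4 \in G ->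
    suzuki_gens e1 e2 e3 e4 -> e1 ^+ 2 != 1 -> e2 ^+ 2 != 1 -> e1 ^+ 2 != e2 ^+ 2 ->
    exists e1 e2 e3 e4, [/\ [/\ e1 \in G, e2 \in G, e3 \in G & e4 \in G], suzuki_gens e1 e2 e3 e4,
      <<[set x in [:: e1; e2; e3; e4]]>> = G
      & forall z, z \in 'Z(G) -> exists i j : bool, z = (e1 ^+ 2) ^+ i * (e2 ^+ 2) ^+ j].
  move=> G1 G2 G3 G4 sg nt1 nt2 nt12; exists e1, e2, e3, e4; split=> //.
    exact: suzuki_gens_generate.
  exact: (klein_center (sqr_center G1) (sqr_center G2)).
have [] := suzuki_tableP table => -[? ? ? ? ? ? ? ?]; subst;
  rewrite ?expg1 ?expg0 ?mulg1 ?mul1g in p13 p14 p23 p24.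
- apply: (conclude x y x' y'); rewrite ?x2 ?y2 //.
  by split; rewrite ?x2 ?y2 ?x2' ?y2' ?ca ?cb.
apply: (conclude y x y' x'); rewrite ?x2 ?y2 //.
by split; rewrite ?x2 ?y2 ?x2' ?y2' ?ca ?cb ?p13 // class2_comm_sym.
Qed.

End Surjective.
End ExponentFour.

(** * Uniqueness of the group with a given commutator table *)

Lemma card_join_cycle2 (gT : finGroupType) (H : {group gT}) e :
  e \in 'N(H) -> e ^+ 2 \in H -> #|H <*> <[e]>| <= 2 * #|H|.
Proof.
move=> nHe He2; rewrite norm_joinEr ?cycle_subG //.
have sub : H * <[e]> \subset H :|: H :* e.
  apply/subsetP=> _ /mulsgP[h _ Hh /cycleP[n ->] ->].
  rewrite -(odd_double_half n) addnC expgD -mul2n expgM in_setU.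
  have Hh' : h * (e ^+ 2) ^+ n./2 \in H by exact: groupM Hh (groupX _ He2).
  rewrite mulgA; case: (odd n); last by rewrite expg0 mulg1 Hh'.
  by rewrite expg1 mem_rcoset mulgK Hh' orbT.
apply: leq_trans (subset_leq_card sub) _; apply: leq_trans (leq_card_setU _ _) _.
by rewrite card_rcoset addnn mul2n.
Qed.

(** Each generator normalizes the subgroup generated by its predecessors and has its square there,
    so adjoining it at most doubles the order. *)
Lemma card_gen_exp2 (gT : finGroupType) (s : seq gT) :
    (forall i, i < size s -> nth 1 s i ^+ 2 \in <<[set x in take i s]>> /\
       forall j, j < i -> [~ nth 1 s j, nth 1 s i] \in <<[set x in take i s]>>) ->
  #|<<[set x in s]>>| <= 2 ^ size s.
Proof.
elim/last_ind: s => [|s e IHs] stepP; first by rewrite set_nil gen0 cards1.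
have [] := stepP (size s); first by rewrite size_rcons.
rewrite nth_rcons ltnn eqxx -cats1 take_size_cat // => He2 He.
have nHe : e \in 'N(<<[set x in s]>>).
  rewrite inE -genJ gen_subG; apply/subsetP=> _ /imsetP[x sx ->].
  rewrite conjg_mulR; apply: groupM; first exact: mem_gen.
  rewrite inE in sx.
  by have := He (index x s); rewrite index_mem nth_cat index_mem sx nth_index //; apply.
have sub : <<[set x in s ++ [:: e]]>> \subset <<[set x in s]>> <*> <[e]>.
  rewrite gen_subG; apply/subsetP=> x; rewrite inE mem_cat inE => /orP[sx | /eqP->].
    by apply: (subsetP (joing_subl _ _)); rewrite mem_gen ?inE.
  by apply: (subsetP (joing_subr _ _)); apply: cycle_id.
apply: leq_trans (subset_leq_card sub) (leq_trans (card_join_cycle2 nHe He2) _).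
rewrite size_cat addn1 expnS leq_mul2l IHs // => i lt_i.
have [] := stepP i; first by rewrite size_rcons ltnW.
rewrite -cats1 nth_cat lt_i takel_cat ?(ltnW lt_i) // => sq_i cm_i; split=> // j lt_ji.
by have := cm_i j lt_ji; rewrite nth_cat (ltn_trans lt_ji lt_i).
Qed.

Lemma suzuki_gens_card (gT : finGroupType) (e1 e2 e3 e4 : gT) :
  suzuki_gens e1 e2 e3 e4 -> #|<<[set x in [:: e1; e2; e3; e4]]>>| <= 64.
Proof.
(* The two squares are listed first, so that all later squares and commutators fall in the subgroup
   they generate. *)
move=> sg; pose s := [:: e1 ^+ 2; e2 ^+ 2; e1; e2; e3; e4].
apply: (@leq_trans #|<<[set x in s]>>|).
  apply/subset_leq_card/genS/subsetP=> x; rewrite !inE.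
  by move=> ->; rewrite !orbT.
apply: (@card_gen_exp2 _ s) => i.
have c11 : [~ e1 ^+ 2, e1] = 1 by apply/commute_commg/commute_sym/commuteX.
have c22 : [~ e2 ^+ 2, e2] = 1 by apply/commute_commg/commute_sym/commuteX.
have c12 : [~ e1 ^+ 2, e2] = 1.
  by apply/commute_commg/commute_sym/commuteX/commute_sym/commgP; rewrite (suz_comm12 sg).
have c21 : [~ e2 ^+ 2, e1] = 1.
  by apply/commute_commg/commute_sym/commuteX/commgP; rewrite (suz_comm12 sg).
have c13 : [~ e1 ^+ 2, e3] = 1.
  by rewrite -(suz_sqr3 sg); apply/commute_commg/commute_sym/commuteX.
have c24 : [~ e2 ^+ 2, e4] = 1.
  by rewrite -(suz_sqr4 sg); apply/commute_commg/commute_sym/commuteX.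
have c00 : [~ e1 ^+ 2, e2 ^+ 2] = 1.
  by apply/commute_commg/commuteX/commgP; rewrite c12.
case: sg => q3 q4 k12 k34 k13 k14 k23 k24 x1 x2 k14' k23'.
have in1 (t : seq gT) : e1 ^+ 2 \in <<[set x in e1 ^+ 2 :: t]>>.
  by rewrite mem_gen // !inE eqxx.
have in2 (t : seq gT) : e2 ^+ 2 \in <<[set x in [:: e1 ^+ 2, e2 ^+ 2 & t]]>>.
  by rewrite mem_gen // !inE eqxx orbT.
have solve (t : seq gT) u : u \in [:: 1; e1 ^+ 2; e2 ^+ 2; e1 ^+ 2 * e2 ^+ 2] ->
    u \in <<[set x in [:: e1 ^+ 2, e2 ^+ 2 & t]]>>.
  by rewrite !inE => /or4P[] /eqP->;
    [apply: group1 | apply: in1 | apply: in2 | apply: groupM (in1 _) (in2 _)].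
case: i => [|[|[|[|[|[|//]]]]]] _ /=; split=> //=; rewrite ?x1 ?x2 ?q3 ?q4 ?group1 //;
  try (apply: solve; rewrite !inE eqxx ?orbT //);
  case=> [|[|[|[|[|//]]]]] //= _; rewrite ?c00 ?group1 //; apply: solve;
  by rewrite ?c11 ?c22 ?c12 ?c21 ?c13 ?c24 ?k12 ?k34 ?k13 ?k14 ?k23 ?k24 ?k14' ?k23' !inE eqxx ?orbT.
Qed.

Lemma suzuki_gens_pair (gT rT : finGroupType) (e1 e2 e3 e4 : gT) (f1 f2 f3 f4 : rT) :
  suzuki_gens e1 e2 e3 e4 -> suzuki_gens f1 f2 f3 f4 ->
  suzuki_gens (e1, f1) (e2, f2) (e3, f3) (e4, f4).
Proof.
have eq_pair (u v : gT * rT) : u.1 = v.1 -> u.2 = v.2 -> u = v.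
  by case: u v => [? ?] [? ?] /= -> ->.
case=> q3 q4 k12 k34 k13 k14 k23 k24 x1 x2 k14' k23'.
case=> q3' q4' l12 l34 l13 l14 l23 l24 x1' x2' l14' l23'.
by split; apply: eq_pair.
Qed.

(* The subgroup of the direct product generated by the pairs of corresponding
   generators is the graph of the morphism: it has at most 64 elements and it
   projects onto [G]. *)
Lemma suzuki_gens_morphism (gT rT : finGroupType) (G : {group gT})
    (e1 e2 e3 e4 : gT) (f1 f2 f3 f4 : rT) :
    suzuki_gens e1 e2 e3 e4 -> suzuki_gens f1 f2 f3 f4 ->
    <<[set x in [:: e1; e2; e3; e4]]>> = G -> #|G| = 64 ->
  exists f : {morphism G >-> rT}, [/\ f e1 = f1, f e2 = f2, f e3 = f3 & f e4 = f4].
Proof.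
move=> sge sgf genG cardG.
pose s := [:: (e1, f1); (e2, f2); (e3, f3); (e4, f4)].
pose K := <<[set x in s]>>%G.
have cardK : #|K| <= 64 := suzuki_gens_card (suzuki_gens_pair sge sgf).
have fstM : {in K &, {morph (fun u : gT * rT => u.1) : u v / u * v}} by [].
have sndM : {in K &, {morph (fun u : gT * rT => u.2) : u v / u * v}} by [].
pose p1 := Morphism fstM; pose p2 := Morphism sndM.
have Ks u : u \in s -> u \in K by move=> su; rewrite mem_gen // inE.
have p1K : p1 @* K = G.
  have gen_s : [set x in [:: e1; e2; e3; e4]] = p1 @* [set x in s].
    rewrite morphimEsub ?subset_gen //; apply/setP=> x; rewrite inE.
    apply/idP/imsetP=> [|[u su ->]]; last first.
      by move: su; rewrite !inE => /or4P[] /eqP->; rewrite eqxx ?orbT.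
    by rewrite !inE => /or4P[] /eqP->;
       [exists (e1, f1) | exists (e2, f2) | exists (e3, f3) | exists (e4, f4)];
       rewrite // !inE eqxx ?orbT.
  by rewrite -genG gen_s -morphim_gen ?subset_gen.
have inj1 : 'injm p1.
  by rewrite -card_im_injm p1K cardG eqn_leq cardK -cardG -p1K leq_morphim.
pose q := ifactm p2 inj1.
have qE u : u \in s -> q u.1 = u.2.
  by move=> su; rewrite [q _](ifactmE p2 inj1 (Ks u su)).
have qM : {in G &, {morph q : x y / x * y}}.
  by rewrite -p1K => x y Gx Gy; rewrite morphM.
by exists (Morphism qM); split; apply: (qE (_, _)); rewrite !inE eqxx ?orbT.
Qed.

(** * The group G64 *)

Section Unitriangular.

Local Open Scope ring_scope.

Variable F : finFieldType.

(** The arguments a, c are the superdiagonal entries from the top, and b is the corner entry. *)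
Definition utri (a c b : F) : 'M[F]_3 :=
  \matrix_(i, j) nth 0 (nth [::] [:: [:: 1; a; b]; [:: 0; 1; c]; [:: 0; 0; 1]] i) j.

Lemma utriM a c b a' c' b' :
  utri a c b *m utri a' c' b' = utri (a + a') (c + c') (b' + a * c' + b).
Proof.
apply/matrixP=> i j; rewrite !mxE !big_ord_recl big_ord0 !mxE.
by case: i j => [[|[|[|//]]] ?] [[|[|[|//]]] ?] /=; ring.
Qed.

Lemma utri1 : utri 0 0 0 = 1%:M.
Proof.
apply/matrixP=> i j; rewrite !mxE.
by case: i j => [[|[|[|//]]] ?] [[|[|[|//]]] ?].
Qed.

Lemma utri_unit a c b : (utri a c b : 'M[F]_3) \is a GRing.unit.
Proof.
have : utri a c b *m utri (- a) (- c) (a * c - b) = 1%:M.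
  by rewrite utriM -utri1; congr (utri _ _ _); ring.
by case/mulmx1_unit.
Qed.

Definition GL3 : finGroupType := {'GL_3[F]}.

Definition utriGL a c b : GL3 := FinRing.unit _ (utri_unit a c b).

Lemma utriGLM a c b a' c' b' :
  (utriGL a c b * utriGL a' c' b')%g = utriGL (a + a') (c + c') (b' + a * c' + b).
Proof. by apply: (@val_inj _ _ {'GL_3[F]}); rewrite /= -utriM. Qed.

Lemma utriGL1 : utriGL 0 0 0 = 1%g.
Proof. by apply: (@val_inj _ _ {'GL_3[F]}); rewrite /= utri1. Qed.

Lemma utriGL_inj a c b a' c' b' : utriGL a c b = utriGL a' c' b' -> [/\ a = a', c = c' & b = b'].
Proof.
move/(congr1 (@GLval 3 F))/matrixP=> /= eqM.
have := eqM 0 1; have := eqM 0 2%R; have := eqM 1 2%R; rewrite !mxE /=; split=> //.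
Qed.

Lemma utri_sesquilinear a c b :
  (map_mx (fun x : F => x ^+ 4) (utri a c b))^T
    *m (\matrix_(i < 3, j < 3) (if ((i : nat) + j == 2)%N then 1 else 0))
    *m utri a c b
  = \matrix_(i, j) nth 0 (nth [::]
      [:: [:: 0; 0; 1]; [:: 0; 1; c + a ^+ 4]; [:: 1; a + c ^+ 4; b + c ^+ 5 + b ^+ 4]] i) j.
Proof.
apply/matrixP=> i j; rewrite !mxE !big_ord_recl big_ord0 !mxE !big_ord_recl !big_ord0 !mxE.
by case: i j => [[|[|[|//]]] ?] [[|[|[|//]]] ?] /=; ring.
Qed.

End Unitriangular.

(** * Suzuki generators over a field of 16 elements *)

Section Characteristic2.

Local Open Scope ring_scope.

Variable F : finFieldType.
Hypotheses (F_char2 : forall x : F, x + x = 0) (F_card : #|F| = 16%N).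

Lemma opp_char2 (x : F) : - x = x.
Proof. by apply/eqP; rewrite eq_sym -addr_eq0 F_char2. Qed.

Lemma exp4D (x y : F) : (x + y) ^+ 4 = x ^+ 4 + y ^+ 4.
Proof.
have sqD (u v : F) : (u + v) ^+ 2 = u ^+ 2 + v ^+ 2.
  by rewrite sqrrD mulr2n F_char2 addr0.
by rewrite (exprM _ 2 2) !sqD -!exprM.
Qed.

Lemma exp16 (x : F) : x ^+ 16 = x.
Proof. by rewrite -F_card expf_card. Qed.

(** The unit group has order 15, so Cauchy gives t of order 5, a root of (t ^ 5 - 1) / (t - 1). *)
Lemma fifth_root : exists t : F, t ^+ 4 + t ^+ 3 + t ^+ 2 + t + 1 = 0.
Proof.
have [|u _ ou] := @Cauchy _ 5 [set: {unit F}]%G isT; first by rewrite card_finField_unit F_card.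
pose t := val u; exists t; have t5 : t ^+ 5 = 1.
  by rewrite -FinRing.val_unitX -ou expg_order.
have nt1 : t - 1 != 0.
  rewrite subr_eq0; apply/eqP=> t1; have u1 : u = 1%g by apply: val_inj.
  by rewrite u1 order1 in ou.
apply: (mulfI nt1); rewrite mulr0.
by transitivity (t ^+ 5 - 1); [ring | rewrite t5 subrr].
Qed.

(** The entry a ^ 4 is forced by the Hermitian form; b remains subject to b + b ^ 4 = a ^ 5, as
    [mem_G64] shows. *)
Definition suz (a b : F) : GL3 F := utriGL a (a ^+ 4) b.

Lemma suz_sqr a b : (suz a b ^+ 2)%g = utriGL 0 0 (a ^+ 5).
Proof.
rewrite expgS expg1 utriGLM !F_char2; congr (utriGL _ _ _).
by rewrite addrAC F_char2 add0r exprS.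
Qed.

Lemma suz_comm a b a' b' :
  [~ suz a b, suz a' b']%g = utriGL 0 0 (a * a' ^+ 4 - a' * a ^+ 4).
Proof.
apply: (mulgI (suz a' b' * suz a b)%g); rewrite -commgC !utriGLM.
by congr (utriGL _ _ _); ring.
Qed.

Lemma utriGL_center (d a c b : F) : [~ utriGL 0 0 d, utriGL a c b]%g = 1%g.
Proof.
by apply/eqP/commgP; rewrite /commute !utriGLM; congr (utriGL _ _ _); ring.
Qed.

Lemma utriGL_center_sqr (d : F) : (utriGL 0 0 d ^+ 2)%g = 1%g.
Proof. by rewrite expgS expg1 utriGLM mul0r !addr0 F_char2 utriGL1. Qed.

Lemma suz_sqr_sqr a b : ((suz a b ^+ 2) ^+ 2)%g = 1%g.
Proof.
have -> := suz_sqr a b.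
exact: utriGL_center_sqr.
Qed.

Lemma suz_sqr_center a b a' b' : [~ suz a b ^+ 2, suz a' b']%g = 1%g.
Proof. by rewrite suz_sqr; apply: utriGL_center. Qed.

Lemma suz_gens a1 b1 a2 b2 a3 b3 a4 b4 :
    a3 ^+ 5 = a1 ^+ 5 -> a4 ^+ 5 = a2 ^+ 5 ->
    a1 * a2 ^+ 4 - a2 * a1 ^+ 4 = 0 -> a3 * a4 ^+ 4 - a4 * a3 ^+ 4 = 0 ->
    a1 * a3 ^+ 4 - a3 * a1 ^+ 4 = a2 ^+ 5 -> a1 * a4 ^+ 4 - a4 * a1 ^+ 4 = a1 ^+ 5 ->
    a2 * a3 ^+ 4 - a3 * a2 ^+ 4 = a1 ^+ 5 ->
    a2 * a4 ^+ 4 - a4 * a2 ^+ 4 = a2 ^+ 5 + a1 ^+ 5 ->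
  suzuki_gens (suz a1 b1) (suz a2 b2) (suz a3 b3) (suz a4 b4).
Proof.
move=> q3 q4 c12 c34 c13 c14 c23 c24; split.
- by rewrite !suz_sqr q3.
- by rewrite !suz_sqr q4.
- by rewrite suz_comm c12 utriGL1.
- by rewrite suz_comm c34 utriGL1.
- by rewrite suz_comm suz_sqr c13.
- by rewrite suz_comm suz_sqr c14.
- by rewrite suz_comm suz_sqr c23.
- by rewrite suz_comm !suz_sqr utriGLM mul0r !addr0 c24.
- exact: suz_sqr_sqr.
- exact: suz_sqr_sqr.
- exact: suz_sqr_center.
- exact: suz_sqr_center.
Qed.

Lemma exists_suz_gens : exists a1 b1 a2 b2 a3 b3 a4 b4,
  [/\ [/\ b1 + b1 ^+ 4 = a1 ^+ 5, b2 + b2 ^+ 4 = a2 ^+ 5,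
          b3 + b3 ^+ 4 = a3 ^+ 5 & b4 + b4 ^+ 4 = a4 ^+ 5],
      suzuki_gens (suz a1 b1) (suz a2 b2) (suz a3 b3) (suz a4 b4),
      a1 ^+ 5 != 0, a2 ^+ 5 != 0 & a1 ^+ 5 + a2 ^+ 5 != 0].
Proof.
have [t t0] := fifth_root.
have t5 : t ^+ 5 = 1.
  by apply/eqP; rewrite -subr_eq0; apply/eqP; transitivity ((t - 1) * 0); [rewrite -t0; ring | rewrite mulr0].
(* This w is a primitive cube root of unity, so monomials in w and t reduce by exponents modulo 3
   and 5. *)
pose w := t ^+ 4 - t.
have wE : t ^+ 4 + t = w by rewrite /w opp_char2.
have w2 : w ^+ 2 = w + 1.
  have -> : w ^+ 2 = t ^+ 5 * t ^+ 3 + t ^+ 2 - (t ^+ 5 + t ^+ 5) by rewrite /w; ring.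
  rewrite F_char2 t5 mul1r subr0; apply/eqP; rewrite -subr_eq0 opp_char2 -wE.
  by apply/eqP; rewrite -[RHS]t0; ring.
have w3 : w ^+ 3 = 1.
  by rewrite exprS w2 mulrDr mulr1 -expr2 w2 addrAC F_char2 add0r.
have w_neq0 : w != 0 by apply: contra_eq_neq w3 => ->; rewrite expr0n eq_sym oner_eq0.
have w10 : w ^+ 10 = w
  by rewrite [LHS](_ : _ = (w ^+ 3) ^+ 3 * w); [rewrite w3 expr1n mul1r | ring].
have w8 : w ^+ 8 = w ^+ 2.
  by rewrite [LHS](_ : _ = (w ^+ 3) ^+ 2 * w ^+ 2); [rewrite w3 expr1n mul1r | ring].
have sq1 : (1 : F) ^+ 5 = 1 by rewrite expr1n.
have sq2 : (w ^+ 2) ^+ 5 = w by rewrite -exprM.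
have sq4 : (w ^+ 2 * t) ^+ 5 = w by rewrite exprMn sq2 t5 mulr1.
have b1 : (t + t ^+ 2) + (t + t ^+ 2) ^+ 4 = 1.
  rewrite exp4D -exprM (_ : t ^+ 8 = t ^+ 5 * t ^+ 3); last by ring.
  rewrite t5 mul1r; apply/eqP; rewrite -subr_eq0 opp_char2; apply/eqP.
  by rewrite -[RHS]t0; ring.
have b2 : t + t ^+ 4 = w by rewrite addrC.
(* The entries a_i are 1, w ^ 2, t and w ^ 2 * t, with fifth powers 1, w, 1, w; b_i is t + t ^ 2 or
   t, for which b + b ^ 4 is 1 or w. *)
exists 1, (t + t ^+ 2), (w ^+ 2), t, t, (t + t ^+ 2), (w ^+ 2 * t), t.
rewrite sq1 sq2 sq4 t5 b1 b2; split=> //; last 2 first.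
- exact: oner_neq0.
- by rewrite addrC -w2 expf_neq0.
have w24 : (w ^+ 2) ^+ 4 = w ^+ 2 by rewrite -exprM w8.
have wt4 : (w ^+ 2 * t) ^+ 4 = w ^+ 2 * t ^+ 4 by rewrite exprMn w24.
apply: suz_gens; rewrite ?wt4 ?w24 ?sq1 ?sq2 ?sq4 ?t5 ?expr1n //.
- by rewrite mul1r mulr1 subrr.
- by ring.
- by rewrite mul1r mulr1.
- by rewrite mul1r mulr1 -mulrBr -/w -exprSr w3.
- by rewrite [t * _]mulrC -mulrBr -/w -exprSr w3.
rewrite [LHS](_ : _ = w ^+ 2 * w ^+ 2 * (t ^+ 4 - t)); last by ring.
by rewrite -/w -mulrA -exprSr mulrC w3 mul1r w2.
Qed.

End Characteristic2.

(** * The unitriangular unitary group over [F16] *)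

Section UnitaryGroup.

Local Open Scope ring_scope.

Lemma F16_char2 (x : F16) : x + x = 0.
Proof. by apply: addrr_pchar2; apply: (s2valP (pPrimePowerField _ _)). Qed.

Lemma F16_card : #|F16| = 16%N.
Proof. exact: (s2valP' (pPrimePowerField _ _)). Qed.

Let o0 : 'I_3 := @Ordinal 3 0 isT.
Let o1 : 'I_3 := @Ordinal 3 1 isT.
Let o2 : 'I_3 := @Ordinal 3 2 isT.

Lemma ord3P (i : 'I_3) : [\/ i = o0, i = o1 | i = o2].
Proof.
by case: i => [[|[|[|//]]] ?]; [constructor 1 | constructor 2 | constructor 3]; apply: val_inj.
Qed.

(** In the form equation, entry (1, 2) gives c = a ^ 4 and entry (2, 2) the condition on b; the
    other entries follow from a ^ 16 = a. *)
Lemma mem_G64 (M : GL3 F16) :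
  reflect (exists a b, b + b ^+ 4 = a ^+ 5 /\ M = suz a b) (M \in G64).
Proof.
rewrite inE; apply: (iffP andP) => [[/forallP tri /eqP form] | [a [b [ab ->]]]]; last first.
  split.
    apply/forallP=> i; apply/forallP=> j; rewrite mxE.
    by case: (ord3P i) => ->; case: (ord3P j) => ->; rewrite ?eqxx.
  have := utri_sesquilinear a (a ^+ 4) b; rewrite /antidiag3 => /= ->.
  apply/eqP/matrixP=> i j; rewrite !mxE.
  have e0 : a ^+ 4 + a ^+ 4 = 0 by apply: F16_char2.
  have e16 : a + (a ^+ 4) ^+ 4 = 0.
    by rewrite -exprM (exp16 F16_card) F16_char2.
  have e20 : b + (a ^+ 4) ^+ 5 + b ^+ 4 = 0.
    rewrite addrAC ab -exprM (_ : a ^+ 20 = a ^+ 16 * a ^+ 4); last by rewrite -exprD.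
    by rewrite (exp16 F16_card) -exprS F16_char2.
  by case: (ord3P i) => ->; case: (ord3P j) => -> /=; rewrite ?e0 ?e16 ?e20.
pose A := GLval M.
have triM (i j : 'I_3) : (j < i)%N -> A i j = 0.
  by move=> lt_ji; have /forallP/(_ j) := tri i; rewrite lt_ji => /andP[/eqP].
have diagM (i : 'I_3) : A i i = 1.
  by have /forallP/(_ i) := tri i; rewrite eqxx => /andP[_ /eqP].
pose a := A o0 o1; pose c := A o1 o2; pose b := A o0 o2.
have defA : A = utri a c b.
  apply/matrixP=> i j; rewrite mxE.
  by case: (ord3P i) => ->; case: (ord3P j) => -> //=; rewrite ?diagM ?triM.
have := utri_sesquilinear a c b; rewrite -defA -[X in _ *m X *m _]/antidiag3 form => eqJ.
have ca : c = a ^+ 4.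
  have := congr1 (fun B : 'M_3 => B o1 o2) eqJ; rewrite !mxE /= => /esym/eqP.
  by rewrite addr_eq0 (opp_char2 F16_char2) => /eqP.
exists a, b; split.
  have := congr1 (fun B : 'M_3 => B o2 o2) eqJ; rewrite !mxE /= => /esym/eqP.
  rewrite addrAC addr_eq0 (opp_char2 F16_char2) => /eqP->.
  rewrite ca -exprM (_ : a ^+ 20 = a ^+ 16 * a ^+ 4); last by rewrite -exprD.
  by rewrite (exp16 F16_card) -exprS.
apply: (@val_inj _ _ {'GL_3[F16]}); rewrite [LHS]/= -/A defA ca //.
Qed.

Lemma G64_group_set : @group_set (GL3 F16) G64.
Proof.
apply/group_setP; split.
  apply/mem_G64; exists 0, 0; rewrite !expr0n addr0; split=> //.
  by rewrite /suz expr0n utriGL1.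
move=> _ _ /mem_G64[a [b [ab ->]]] /mem_G64[a' [b' [ab' ->]]].
apply/mem_G64; exists (a + a'), (b' + a * a' ^+ 4 + b).
have exp4 := exp4D F16_char2; rewrite /suz utriGLM; split; last by rewrite (exp4 a a').
rewrite (exp4 (b' + a * a' ^+ 4) b) (exp4 b')
  [in LHS]exprMn -exprM (exp16 F16_card a') (exprSr (a + a') 4) (exp4 a a').
transitivity ((b + b ^+ 4) + (b' + b' ^+ 4) + (a * a' ^+ 4 + a ^+ 4 * a')); first by ring.
rewrite ab ab'; ring.
Qed.

Lemma card_G64 : (#|G64| <= 64)%N.
Proof.
pose P := [set u : F16 * F16 | u.2 + u.2 ^+ 4 == u.1 ^+ 5].
have sub : (G64 : {set GL3 F16}) \subset [set suz u.1 u.2 | u in P].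
  apply/subsetP=> _ /mem_G64[a [b [ab ->]]]; apply/imsetP; exists (a, b) => //.
  by rewrite inE ab.
apply: leq_trans (subset_leq_card sub) (leq_trans (leq_imset_card _ _) _).
rewrite (@card_fibers _ _ _ setT fst) //.
have le4 (a : F16) : (#|[set u in P | u.1 == a]| <= 4)%N.
  (* For fixed a the admissible b are roots of a polynomial of degree 4, so there are at most 16 * 4
     elements. *)
  pose Q : {poly F16} := 'X^4 + ('X - (a ^+ 5)%:P).
  have szQ : size Q = 5%N.
    by rewrite size_polyDl size_polyXn // size_XsubC.
  pose rs := [seq u.2 | u <- enum [set u in P | u.1 == a]].
  have -> : #|[set u in P | u.1 == a]| = size rs by rewrite size_map -cardE.
  rewrite -ltnS -szQ; apply: max_poly_roots.
  - by rewrite -size_poly_eq0 szQ.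
  - apply/allP=> _ /mapP[[a' b] ub ->]; move: ub; rewrite mem_enum !inE /= => /andP[/eqP eqb /eqP eqa].
    rewrite /root hornerD hornerXn hornerXsubC /= addrCA addrA eqb -eqa subrr //.
  rewrite map_inj_in_uniq ?enum_uniq // => -[a1 b1] [a2 b2].
  by rewrite !mem_enum !inE /= => /andP[_ /eqP ->] /andP[_ /eqP ->] ->.
apply: (@leq_trans (\sum_(a in [set: F16]) 4)); first by apply: leq_sum => a _; apply: le4.
by rewrite sum_nat_const cardsT F16_card.
Qed.

End UnitaryGroup.

(** The morphism to matrices is injective on the center, since e1 ^ 2, e2 ^ 2 and their product have
    nontrivial images; a nontrivial kernel would meet the center of the 2-group. The image has 64
    elements and lies in [G64], which has at most 64. *)
Lemma suzuki_gens_isog (gT : finGroupType) (G : {group gT}) (e1 e2 e3 e4 : gT) :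
    2.-group G -> #|G| = 64 -> suzuki_gens e1 e2 e3 e4 ->
    <<[set x in [:: e1; e2; e3; e4]]>> = G ->
    (forall z, z \in 'Z(G) -> exists i j : bool, z = (e1 ^+ 2) ^+ i * (e2 ^+ 2) ^+ j) ->
  G \isog G64.
Proof.
move=> pG cardG sg genG ZG.
have [a1 [b1 [a2 [b2 [a3 [b3 [a4 [b4 [[m1 m2 m3 m4] sg' nt1 nt2 nt12]]]]]]]]] :=
  exists_suz_gens F16_char2 F16_card.
have [f [f1 f2 f3 f4]] := suzuki_gens_morphism sg sg' genG cardG.
have Gs x : x \in [:: e1; e2; e3; e4] -> x \in G by move=> sx; rewrite -genG mem_gen // inE.
have G1 : e1 \in G by apply: Gs; rewrite !inE eqxx.
have G2 : e2 \in G by apply: Gs; rewrite !inE eqxx orbT.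
have injf : 'injm f.
  have [-> // | ntK] := eqVneq ('ker f) 1.
  have : 'ker f :&: 'Z(G) != 1.
    by apply: meet_center_nil ntK; [apply: pgroup_nil pG | apply: ker_normal].
  case/trivgPn=> z /setIP[kz Zz] ntz; have [i [j def_z]] := ZG z Zz.
  have := mker kz; rewrite def_z morphM ?groupX // !morphX ?groupX // f1 f2 !(suz_sqr F16_char2).
  have utri0 (x : F16) : utriGL 0%R 0%R x = 1 -> x = 0%R.
    by rewrite -utriGL1 => /utriGL_inj[].
  move: ntz; rewrite def_z; case: (i) (j) => [] []; rewrite ?expg1 ?expg0 ?mulg1 ?mul1g ?eqxx // => _.
  - by rewrite utriGLM mul0r !addr0 => /utri0/eqP; rewrite addrC (negPf nt12).
  - by move/utri0/eqP; rewrite (negPf nt1).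
  - by move/utri0/eqP; rewrite (negPf nt2).
have sub : f @* G \subset (G64 : {set GL3 F16}).
  have -> : f @* G = f @* <<[set x in [:: e1; e2; e3; e4]]>> by rewrite genG.
  rewrite morphim_gen; last by apply/subsetP=> x; rewrite inE; apply: Gs.
  rewrite -[G64]/(gval (Group G64_group_set)) gen_subG; apply/subsetP=> _ /morphimP[x _ sx ->].
  apply/mem_G64; move: sx; rewrite !inE => /or4P[] /eqP->.
  - by exists a1, b1.
  - by exists a2, b2.
  - by exists a3, b3.
  - by exists a4, b4.
have imf : f @* G = (G64 : {set GL3 F16}).
  have cardf : #|f @* G| = 64 by rewrite card_injm.
  by apply/eqP; rewrite eqEcard sub cardf; apply: card_G64.
by have := sub_isog (subxx G) injf; rewrite imf.
Qed.

Theorem theorem4p11 (p : nat) (gT : finGroupType) (G : {group gT}) :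
  prime p -> (p.-group G)%g -> two_tuple_regular G ->
  [\/ homocyclic G, (G \isog 'Q_8)%g | (G \isog G64)%g].
Proof.
move=> p_pr pG regG; have [cG | ncG] := boolP (abelian G).
  by constructor 1; apply: reg_abelian_homocyclic p_pr pG regG cG.
have [p2 ZE E4] := nonabelian_reg_exp4 p_pr pG regG ncG; subst p.
have [big | small] := boolP [exists x in G, exists y in G, [~ x, y] \notin <[x]>].
  have big_commg : exists2 x, x \in G & exists2 y, y \in G & [~ x, y] \notin <[x]>.
    by have /exists_inP[x Gx /exists_inP[y Gy nxy]] := big; exists x => //; exists y.
  have [e1 [e2 [e3 [e4 [_ sg genG ZG]]]]] := exists_suzuki_gens pG regG ncG ZE E4 big_commg.
  constructor 3; apply: suzuki_gens_isog sg genG ZG => //.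
  exact: card_group64 big_commg.
constructor 2; apply: cycle_commg_quaternion => // x y Gx Gy.
move: small; rewrite negb_exists_in => /forall_inP/(_ x Gx).
by rewrite negb_exists_in => /forall_inP/(_ y Gy)/negPn.
Qed.
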